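(* Let $n$ be the dimension and let $\rho,\lambda,\Lambda>0$. There exist positive constants $c_0,C_1,C_2$ depending only on $\rho,\lambda,\Lambda$ and $n$ such that the following holds. Let $\Omega\subset\mathbb{R}^n$ be a convex domain and $\phi:\overline\Omega\to\mathbb{R}$ a convex function satisfying the structural conditions (H) with constants $\rho,\lambda,\Lambda$. Then for any section $S_\phi(x,t)$ with $x\in\overline\Omega$ and $0<t\le c_0$, $$C_1 t^{n/2}\le |S_\phi(x,t)|\le C_2 t^{n/2}.$$
   Context: Structural conditions (H) with constants $\rho,\lambda,\Lambda>0$: (1) $\Omega\subset B_{1/\rho}$ (the ball of radius $1/\rho$ centered at the origin), and for every $x_0\in\partial\Omega$ there is an open ball of radius $\rho$ contained in $\Omega$ and tangent to $\partial\Omega$ at $x_0$; (2) $\phi\in C^{0,1}(\overline\Omega)\cap C^2(\Omega)$ is convex and $\det D^2\phi=g$ in $\Omega$ with $0<\lambda\le g\le\Lambda$; (3) $\rho|x-x_0|^2\le\phi(x)-\phi(x_0)-\nabla\phi(x_0)\cdot(x-x_0)\le\rho^{-1}|x-x_0|^2$ for all $x,x_0\in\partial\Omega$. At boundary points, $\nabla\phi(x_0)$ denotes the value of the continuous extension of $\nabla\phi$ to $\overline\Omega$. The section of $\phi$ centered at $x\in\overline\Omega$ with height $h>0$ is $S_\phi(x,h):=\{y\in\overline\Omega:\ \phi(y)<\phi(x)+\nabla\phi(x)\cdot(y-x)+h\}$. $|E|$ denotes the $n$-dimensional Lebesgue measure of $E$. *)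

(* Defs.v *)
From HB Require Import structures.
From mathcomp Require Import all_boot all_order all_algebra.
From mathcomp Require Import all_classical all_reals all_analysis.

Set Implicit Arguments.
Unset Strict Implicit.
Unset Printing Implicit Defensive.

Import Order.TTheory GRing.Theory Num.Theory.
Import numFieldNormedType.Exports.

Local Open Scope classical_set_scope.
Local Open Scope ring_scope.

Section euclidean.
Context {R : realType} {n : nat}.
Implicit Types x y c : 'rV[R]_n.

Definition dotv x y : R := \sum_(i < n) x 0 i * y 0 i.

(* The norm `|x| that MathComp-Analysis puts on row vectors is the sup norm. *)
Definition enorm x : R := Num.sqrt (dotv x x).

Definition eball c (r : R) : set 'rV[R]_n := [set x | enorm (x - c) < r].

Definition bdry (U : set 'rV[R]_n) : set 'rV[R]_n := closure U `\` interior U.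

End euclidean.

Section lebesgue.
Context {R : realType} {n : nat}.
Implicit Types (a b : 'rV[R]_n) (E : set 'rV[R]_n).

Definition box a b : set 'rV[R]_n :=
  [set x | forall i, a 0 i <= x 0 i <= b 0 i].

Definition box_volume a b : R := \prod_(i < n) (b 0 i - a 0 i).

Definition box_cover E (a b : nat -> 'rV[R]_n) : Prop :=
  (forall k i, a k 0 i <= b k 0 i) /\ E `<=` \bigcup_k box (a k) (b k).

(* n-dimensional Lebesgue outer measure (for 0 < n), which is the Lebesgue
   measure on Lebesgue measurable sets. *)
Definition lebesgue_rV E : \bar R :=
  ereal_inf [set s | exists a b : nat -> 'rV[R]_n, box_cover E a b /\
    s = (\sum_(k <oo) (box_volume (a k) (b k))%:E)%E].

End lebesgue.

Section lebesgue_outer_measure.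
Context {R : realType} {n : nat}.
Local Open Scope ereal_scope.

Local Notation leb := (@lebesgue_rV R n.+1).

Let box_volume_ge0 (a b : 'rV[R]_n.+1) :
  (forall i, (a 0 i <= b 0 i)%R) -> 0 <= (box_volume a b)%:E.
Proof. by move=> ab; rewrite lee_fin prodr_ge0// => i _; rewrite subr_ge0. Qed.

Let leb_ge0 E : 0 <= leb E.
Proof.
apply/le_ereal_inf_tmp => _ [a [b [[ab _] ->]]].
by apply: nneseries_ge0 => k _ _; exact: box_volume_ge0.
Qed.

Let leb0 : leb set0 = 0.
Proof.
apply/eqP; rewrite eq_le leb_ge0 andbT; apply: ereal_inf_lbound.
exists (fun=> 0%R), (fun=> 0%R); split; first by split => // k i.
rewrite eseries0// => k _ _.
by rewrite /box_volume big_ord_recl subrr mul0r.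
Qed.

Let le_leb : {homo leb : A B / A `<=` B >-> A <= B}.
Proof.
move=> A B AB; apply: ereal_inf_le_tmp => _ [a [b [[ab BE] ->]]].
by exists a, b; split => //; split => //; exact: subset_trans BE.
Qed.

Let leb_sigma_subadditive : sigma_subadditive leb.
Proof.
move=> A; have [[i ioo]|] := pselect (exists i, leb (A i) = +oo).
  rewrite (eseries_pinfty _ _ ioo) ?leey// => k _.
  by rewrite -ltNye (lt_le_trans _ (leb_ge0 _)).
rewrite -forallNE => Aoo.
apply/lee_addgt0Pr => e e0.
rewrite (le_trans _ (epsilon_trick _ _ (ltW e0)))//.
pose P k (ab : (nat -> 'rV[R]_n.+1) * (nat -> 'rV[R]_n.+1)) :=
  box_cover (A k) ab.1 ab.2 /\
  \sum_(j <oo) (box_volume (ab.1 j) (ab.2 j))%:E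
    <= leb (A k) + (e / (2 ^ k.+1)%:R)%:E.
have [G PG] : {G & forall k, P k (G k)}.
  apply: (@choice _ _ P) => k.
  have lfin : leb (A k) \is a fin_num.
    by rewrite ge0_fin_numE// ltey; apply/eqP; exact: Aoo.
  have ek : (0 < e / (2 ^ k.+1)%:R)%R by rewrite divr_gt0// ltr0n expn_gt0.
  have [_ [a [b [ab ->]]] /ltW h] := lb_ereal_inf_adherent ek lfin.
  by exists (a, b).
pose v (p : nat * nat) := (box_volume ((G p.1).1 p.2) ((G p.1).2 p.2))%:E.
have v_ge0 p : 0 <= v p by apply: box_volume_ge0 => i; exact: (PG p.1).1.1.
apply: (@le_trans _ _ (\esum_(p in setT) v p)).
  apply: ereal_inf_lbound => /=.
  have /card_esym/ppcard_eqP[f] := card_nat2.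
  exists (fun k => (G (f k).1).1 (f k).2), (fun k => (G (f k).1).2 (f k).2).
  split; first split.
  - by move=> k i; exact: (PG (f k).1).1.1.
  - move=> x [i _ /((PG i).1.2) [j _ xij]].
    by exists (f^-1%FUN (i, j)) => //=; rewrite invK ?inE.
  have -> : \esum_(p in setT) v p = \esum_(p in f @` setT) v p by rewrite image_eq.
  rewrite -(esum_pred_image v _ xpredT) ?[fun=> _]set_true//.
  by congr esum; apply/seteqP; split=> p [k _ <-]; exists k.
rewrite (_ : esum _ _ = \sum_(i <oo) \sum_(j <oo) v (i, j)); last first.
  pose J : nat -> set (nat * nat) := fun i => [set (i, j) | j in setT].
  rewrite (_ : setT = \bigcup_k J k); last first.
    by rewrite predeqE => -[a b]; split => // _; exists a => //; exists b.
  rewrite esum_bigcupT //=; last first.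
    apply/trivIsetP => i j _ _ ij.
    rewrite predeqE => -[k m] /=; split => //= -[] [_] _ [<-{k} _].
    by move=> [m' _] [] /esym/eqP; rewrite (negbTE ij).
  rewrite -(image_id [set: nat]) -fun_true esum_pred_image//; last first.
    by move=> k _; exact: esum_ge0.
  apply: eq_eseriesr => /= j _.
  rewrite -(esum_pred_image v (pair j) predT)//=; last first.
    by move=> ? ? _ _; exact: (@can_inj _ _ _ snd).
  by congr esum; rewrite predeqE => -[a b]; split; move=> [i _ <-]; exists i.
apply: lee_lim.
- by apply: is_cvg_nneseries => k _ _; apply: nneseries_ge0 => m _ _.
- apply: is_cvg_nneseries => k _ _; apply: adde_ge0 => //.
  by rewrite lee_fin divr_ge0// ltW.
- by near=> k; apply: lee_sum => i _; exact: (PG i).2.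
Unshelve. all: by end_near. Qed.

HB.instance Definition _ := isOuterMeasure.Build R 'rV[R]_n.+1
  (@lebesgue_rV R n.+1) leb0 leb_ge0 le_leb leb_sigma_subadditive.

End lebesgue_outer_measure.

Section calculus.
Context {R : realType} {n : nat}.
Implicit Types (f phi : 'rV[R]_n -> R) (U : set 'rV[R]_n).

Definition partial f (i : 'I_n) : 'rV[R]_n -> R :=
  fun x => 'D_(delta_mx 0 i) f x.

Definition C1_on U f : Prop := forall i x, U x ->
  derivable f x (delta_mx 0 i) /\ {for x, continuous (partial f i)}.

Definition C2_on U f : Prop :=
  C1_on U f /\ forall i, C1_on U (partial f i).

Definition grad f x : 'rV[R]_n := \row_(i < n) partial f i x.

Definition hessian f x : 'M[R]_n :=
  \matrix_(i < n, j < n) partial (partial f i) j x.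

(* Dphi is the continuous extension to [closure U] of the gradient of phi on
   the open set U; only its values on [closure U] are meaningful. *)
Definition grad_extension U phi (Dphi : 'rV[R]_n -> 'rV[R]_n) : Prop :=
  {within closure U, continuous Dphi} /\ {in U, Dphi =1 grad phi}.

End calculus.

Section monge_ampere.
Context {R : realType} {n : nat}.
Implicit Types (Omega : set 'rV[R]_n) (phi g : 'rV[R]_n -> R).
Implicit Types (Dphi : 'rV[R]_n -> 'rV[R]_n).

Definition convex_domain Omega : Prop :=
  [/\ open Omega, Omega !=set0 & convex_set Omega].

(* Functions on [closure Omega] are represented by total functions of which
   only the values on [closure Omega] (on Omega for g) are constrained. *)
Record structural_conditions (rho lambda Lambda : R)
    Omega phi Dphi g : Prop := StructuralConditions {
  bounded_domain : Omega `<=` eball 0 rho^-1 ;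
  (* A ball contained in Omega is tangent to the boundary at x0 exactly when
     x0 lies on its bounding sphere. *)
  interior_ball : forall x0, bdry Omega x0 ->
    exists c, eball c rho `<=` Omega /\ enorm (x0 - c) = rho ;
  phi_lipschitz : [lipschitz phi x | x in closure Omega] ;
  phi_C2 : C2_on Omega phi ;
  phi_convex : convex_function (closure Omega) phi ;
  phi_grad : grad_extension Omega phi Dphi ;
  monge_ampere_eq : forall x, Omega x -> \det (hessian phi x) = g x ;
  monge_ampere_bounds : forall x, Omega x -> lambda <= g x <= Lambda ;
  quadratic_separation : forall x x0, bdry Omega x -> bdry Omega x0 ->
    rho * enorm (x - x0) ^+ 2
      <= phi x - phi x0 - dotv (Dphi x0) (x - x0)
      <= rho^-1 * enorm (x - x0) ^+ 2
}.

Definition msection Omega phi Dphi (x : 'rV[R]_n) (h : R) : set 'rV[R]_n :=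
  [set y | closure Omega y /\ phi y < phi x + dotv (Dphi x) (y - x) + h].

End monge_ampere.

(* Main.v *)
Require Import Defs.
From mathcomp Require Import all_boot all_order all_algebra.
From mathcomp Require Import all_classical all_reals all_analysis.
From mathcomp Require Import measurable_realfun.
From mathcomp Require Import ring lra.

Set Implicit Arguments.
Unset Strict Implicit.
Unset Printing Implicit Defensive.

Import Order.TTheory GRing.Theory Num.Theory.
Import numFieldNormedType.Exports.

Local Open Scope classical_set_scope.
Local Open Scope ring_scope.

(** Write [gap x y] for the height of the graph of [phi] at [y] above the
tangent plane at [x]. A section is squeezed between two sublevel sets of the gap,
which are compact and convex, so everything reduces to the size of such a
sublevel set [K] of height [s].

Normal form. A greedy choice of triangular coordinates ([normal_form]) writes a
convex body as [y0] plus something between a small and a unit cell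
[|(z *m E) 0 k| <= 1], with volume comparable to [D], where
[D ^- 2 = det (E *m E^T)]. Triangularity lets the measure of the cells be
computed by hand from boxes: from above by slicing, from below by integrating
one variable at a time. The statement becomes: [D ^ 2] is comparable to [s ^ n].

Upper bound. On the cell inside [K] the gap lies between [0] and [s], so a
quadratic polynomial with Hessian of order [s *: E *m E^T] touches it from above
at an interior point. There the Hessian of [phi] is dominated, and its
determinant, at least [lambda], is at most a constant times [s ^ n * D ^- 2]
([sublevel_size_le]).

Lower bound. Conversely a quadratic polynomial whose Monge-Ampere mass exceeds
[Lambda] cannot touch the gap from below at an interior point ([comparison]). If
[D ^ 2] were much smaller than [s ^ n], the quadratic [s / 4] plus a small
multiple of [s * |(y - x) *m E| ^ 2] would be such a polynomial, and it lies below
the gap on the boundary of [K], although not at [x]. This settles the case when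
[K] stays away from the boundary of [Omega].

Otherwise the section of [x] contains a comparable sublevel set centred at the
boundary point [z] where the gap of [x] is least: there the gradient of the gap is
an outward normal or zero ([gap_min_normal]), hence adds something nonpositive on
[Omega]. So let [x] be on the boundary, with inner normal [nu]. The barrier is now
a small multiple of [s * |(y - x) *m E| ^ 2] plus a small multiple of
[dotv nu (y - x)]; staying below the gap, it would give the gap a positive normal
slope at [x], which is absurd as the gradient of the gap vanishes there
([gap_sublinear]). What has to be checked is that it is below the gap on the
boundary of [Omega], where the gap is at least [rho * |y - x| ^ 2], that is
[|(y - x) *m E| <= C |y - x| / sqrt s] ([bdry_slope_le]). Tangentially this holds
because [K] contains a piece of the boundary of size [sqrt s]. Normally it is
enough that [K] contains a point whose height over the tangent plane is a large
multiple of [s], because boundary points at distance [d] have height [O(d ^ 2)]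
only; and such a point exists ([exists_high_point]) since otherwise a fixed
quadratic barrier contradicts the vanishing normal slope. *)

(** * Euclidean structure and neighbourhoods of row vectors *)

Lemma exists_below (R : realType) (a b : R) : 0 < a -> 0 < b ->
  exists m, [/\ 0 < m, m < a & m < b].
Proof.
move=> a0 b0; have m0 : 0 < Num.min a b by rewrite lt_min a0.
have ma : Num.min a b <= a by rewrite ge_min lexx.
have mb : Num.min a b <= b by rewrite ge_min lexx orbT.
by exists (Num.min a b / 2); split; lra.
Qed.

Section euclidean_structure.
Context {R : realType} {n : nat}.
Implicit Types (x y z v w : 'rV[R]_n) (a : R).

Lemma dotvC x y : dotv x y = dotv y x.
Proof. by apply: eq_bigr => i _; rewrite mulrC. Qed.

Lemma dotvDl x y z : dotv (x + y) z = dotv x z + dotv y z.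
Proof. by rewrite /dotv -big_split; apply: eq_bigr => i _; rewrite mxE mulrDl. Qed.

Lemma dotvZl a x y : dotv (a *: x) y = a * dotv x y.
Proof. by rewrite /dotv mulr_sumr; apply: eq_bigr => i _; rewrite mxE mulrA. Qed.

Lemma dotvDr x y z : dotv z (x + y) = dotv z x + dotv z y.
Proof. by rewrite dotvC dotvDl !(dotvC z). Qed.

Lemma dotvZr a x y : dotv x (a *: y) = a * dotv x y.
Proof. by rewrite dotvC dotvZl dotvC. Qed.

Lemma dotvNl x y : dotv (- x) y = - dotv x y.
Proof. by rewrite -scaleN1r dotvZl mulN1r. Qed.

Lemma dotvNr x y : dotv x (- y) = - dotv x y.
Proof. by rewrite dotvC dotvNl dotvC. Qed.

Lemma dotvBl x y z : dotv (x - y) z = dotv x z - dotv y z.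
Proof. by rewrite dotvDl dotvNl. Qed.

Lemma dotvBr x y z : dotv z (x - y) = dotv z x - dotv z y.
Proof. by rewrite dotvDr dotvNr. Qed.

Lemma dotv_sqrD x y : dotv (x + y) (x + y) = dotv x x + 2 * dotv x y + dotv y y.
Proof. by rewrite dotvDl !dotvDr (dotvC y x); ring. Qed.

Lemma dotv_sqrB x y : dotv (x - y) (x - y) = dotv x x - 2 * dotv x y + dotv y y.
Proof. by rewrite dotv_sqrD dotvNr dotvNl dotvNr; ring. Qed.

Lemma dotv_sqrZ a x : dotv (a *: x) (a *: x) = a ^+ 2 * dotv x x.
Proof. by rewrite dotvZl dotvZr; ring. Qed.

Lemma dot0v x : dotv 0 x = 0.
Proof. by rewrite -(scale0r x) dotvZl mul0r. Qed.

Lemma dotv0 x : dotv x 0 = 0.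
Proof. by rewrite dotvC dot0v. Qed.

Lemma dotv_ge0 x : 0 <= dotv x x.
Proof. by apply: sumr_ge0 => i _; rewrite -expr2 sqr_ge0. Qed.

Lemma sqr_coord_le_dotv x i : x 0 i ^+ 2 <= dotv x x.
Proof.
rewrite /dotv (bigD1 i)//= -expr2 lerDl.
by apply: sumr_ge0 => j _; rewrite -expr2 sqr_ge0.
Qed.

Lemma dotv_eq0 x : dotv x x = 0 -> x = 0.
Proof.
move=> x0; apply/rowP => i; rewrite mxE; apply/eqP.
by rewrite -sqrf_eq0 eq_le sqr_ge0 andbT -x0 sqr_coord_le_dotv.
Qed.

Lemma dotv_gt0 x : x != 0 -> 0 < dotv x x.
Proof.
move=> x0; rewrite lt_neqAle dotv_ge0 andbT eq_sym.
by apply: contra x0 => /eqP/dotv_eq0/eqP.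
Qed.

Lemma enorm_ge0 x : 0 <= enorm x.
Proof. exact: sqrtr_ge0. Qed.

Lemma sqr_enorm x : enorm x ^+ 2 = dotv x x.
Proof. by rewrite sqr_sqrtr// dotv_ge0. Qed.

Lemma enorm_lt x (r : R) : 0 < r -> (enorm x < r) = (dotv x x < r ^+ 2).
Proof.
by move=> r0; rewrite -sqr_enorm -ltr_sqr// ?nnegrE ?enorm_ge0// ltW.
Qed.

Lemma cauchy_schwarz x y : dotv x y ^+ 2 <= dotv x x * dotv y y.
Proof.
have [->|y0] := eqVneq y 0; first by rewrite !dotv0 expr0n mulr0.
have yy := dotv_gt0 y0.
have := dotv_ge0 (dotv y y *: x - dotv x y *: y).
rewrite !(dotvBl, dotvBr, dotvZl, dotvZr) (dotvC y x) => h.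
rewrite -(ler_pM2l yy) -subr_ge0; apply: le_trans h _.
by rewrite le_eqVlt; apply/orP; left; apply/eqP; ring.
Qed.

Lemma dotv_delta x i : dotv x (delta_mx 0 i) = x 0 i.
Proof.
rewrite /dotv (bigD1 i)//= mxE !eqxx mulr1 big1 ?addr0// => j ji.
by rewrite mxE (negbTE ji) andbF mulr0.
Qed.

Lemma normr_dotv_le x y (d : R) : (forall i, `|y 0 i| <= d) ->
  `|dotv x y| <= (\sum_i `|x 0 i|) * d.
Proof.
move=> yd; rewrite /dotv mulr_suml; apply: le_trans (ler_norm_sum _ _ _) _.
by apply: ler_sum => i _; rewrite normrM ler_wpM2l.
Qed.

(** The arguments below are quantitative and use cubes instead of filters. *)
Lemma nbhs_cubeP x (P : set 'rV[R]_n) :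
  nbhs x P <-> exists2 d : R, 0 < d &
    forall y, (forall i, `|y 0 i - x 0 i| < d) -> P y.
Proof.
split=> [/nbhs_ballP[d /= d0 dP]|[d d0 dP]].
  exists d => // y yd; apply: dP; split=> // i j.
  by rewrite ord1 -ball_normE/= distrC.
apply/nbhs_ballP; exists d => // y [_ yd]; apply: dP => i.
by have := yd 0 i; rewrite -ball_normE/= distrC.
Qed.

Lemma line_in_cube z v (d : R) : 0 < d -> exists2 e : R, 0 < e &
  forall s : R, `|s| < e -> forall i, `|(z + s *: v) 0 i - z 0 i| < d.
Proof.
move=> d0; have S0 : 0 < 1 + \sum_i `|v 0 i| by rewrite ltr_pwDl// sumr_ge0.
exists (d / (1 + \sum_i `|v 0 i|)); first exact: divr_gt0.
move=> s; rewrite ltr_pdivlMr// => sd i; rewrite !mxE addrAC subrr add0r normrM.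
apply: le_lt_trans sd; rewrite ler_wpM2l// (bigD1 i)//= addrCA lerDl addr_ge0//.
exact: sumr_ge0.
Qed.

Lemma open_cube (U : set 'rV[R]_n) x : open U -> U x ->
  exists2 d : R, 0 < d & forall y, (forall i, `|y 0 i - x 0 i| < d) -> U y.
Proof. by move=> oU Ux; apply/nbhs_cubeP; exact: open_nbhs_nbhs. Qed.

Lemma continuous_cube (f : 'rV[R]_n -> R) x (e : R) :
  {for x, continuous f} -> 0 < e ->
  exists2 d : R, 0 < d &
    forall y, (forall i, `|y 0 i - x 0 i| < d) -> `|f y - f x| < e.
Proof.
move=> fx e0; apply/nbhs_cubeP.
have /cvgr_dist_lt/(_ e e0) : f @ nbhs x --> f x by [].
by apply: filterS => y; rewrite distrC.
Qed.

Lemma closure_cubeP (U : set 'rV[R]_n) x : closure U x <->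
  forall d : R, 0 < d -> exists2 y, U y & forall i, `|y 0 i - x 0 i| < d.
Proof.
split=> [cU d d0|cU B /nbhs_cubeP[d d0 dB]].
  have [|y [Uy yB]] := cU [set y | forall i, `|y 0 i - x 0 i| < d].
    by apply/nbhs_cubeP; exists d.
  by exists y.
by have [y Uy yd] := cU d d0; exists y; split=> //; exact: dB.
Qed.

Lemma cube_continuous (f : 'rV[R]_n -> R) x :
  (forall e : R, 0 < e -> exists2 d : R, 0 < d &
    forall y, (forall i, `|y 0 i - x 0 i| < d) -> `|f y - f x| < e) ->
  {for x, continuous f}.
Proof.
move=> fx A /= /nbhs_ballP[e /= e0 eA]; have [d d0 df] := fx e e0.
apply/nbhs_cubeP; exists d => // y yx; apply: eA.
by rewrite -ball_normE/= distrC; exact: df.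
Qed.

Lemma continuous_dotv x : continuous (dotv x).
Proof.
move=> y; apply: cube_continuous => e e0.
have S0 : 0 < 1 + \sum_i `|x 0 i| by rewrite ltr_pwDl// sumr_ge0.
exists (e / (1 + \sum_i `|x 0 i|)); first by rewrite divr_gt0.
move=> z zy; rewrite -dotvBr.
apply: le_lt_trans (@normr_dotv_le x _ (e / (1 + \sum_i `|x 0 i|)) _) _.
  by move=> i; rewrite !mxE ltW.
by rewrite mulrCA gtr_pMr// ltr_pdivrMr// mul1r ltr_pwDl.
Qed.

End euclidean_structure.

(** * Second-order calculus along lines *)

Section calculus_lemmas.
Context {R : realType} {n : nat}.
Implicit Types (x y z v w : 'rV[R]_n) (f : 'rV[R]_n -> R) (U : set 'rV[R]_n).

Lemma is_derive_line f x v (s : R) : derivable f (x + s *: v) v ->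
  is_derive s (1 : R) (fun h : R => f (x + h *: v)) ('D_v f (x + s *: v)).
Proof.
have E : (fun h : R => h^-1 *: ((fun k : R => f (x + k *: v)) (h *: (1 : R) + s)
              - f (x + s *: v)))
    = (fun h : R => h^-1 *: (f (h *: v + (x + s *: v)) - f (x + s *: v))).
  apply/funext => h; congr (_ *: (f _ - _)).
  by rewrite [h *: 1]mulr1 scalerDl addrCA.
move=> df; apply: DeriveDef.
  by rewrite /derivable E.
by rewrite /derive E.
Qed.

(** Signed form of the mean value theorem, for increments of either sign. *)
Lemma mvt_ball (g dg : R -> R) (d h : R) :
  (forall s, `|s| < d -> is_derive s (1 : R) g (dg s)) -> `|h| < d ->
  exists2 s, `|s| <= `|h| & g h - g 0 = dg s * h.
Proof.
move=> gd hd.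
have cg (a b : R) : `|a| < d -> `|b| < d -> {within `[a, b], continuous g}.
  move=> ad bd; apply: derivable_within_continuous => s; rewrite in_itv/= => sab.
  have : `|s| < d by move: ad bd sab; rewrite !ltr_norml => *; lra.
  by move=> /gd [].
have d0 : 0 < d by apply: le_lt_trans hd.
have [h0|h0|<-] := ltgtP 0 h.
- have [||s] := @MVT _ g dg 0 h h0.
  + move=> s; rewrite in_itv/= => sh; apply: gd.
    by move: hd sh; rewrite !ltr_norml => *; lra.
  + by apply: cg => //; rewrite normr0.
  + rewrite in_itv/= subr0 => sh E; exists s => //.
    by rewrite !ger0_norm; lra.
- have [||s] := @MVT _ g dg h 0 h0.
  + move=> s; rewrite in_itv/= => sh; apply: gd.
    by move: hd sh; rewrite !ltr_norml => *; lra.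
  + by apply: cg => //; rewrite normr0.
  + rewrite in_itv/= sub0r => sh E; exists s; last by lra.
    by rewrite !ler0_norm; lra.
- by exists 0; rewrite ?subrr ?mulr0 ?normr0.
Qed.

(** Continuous partial derivatives give a first-order expansion: move from [x]
to [x + w] one coordinate at a time and apply the mean value theorem on each
leg. *)
Lemma C1_expansion U f x (e : R) : open U -> C1_on U f -> U x -> 0 < e ->
  exists2 d : R, 0 < d & forall w, (forall i, `|w 0 i| < d) ->
    U (x + w) /\
    `|f (x + w) - f x - dotv (grad f x) w| <= e * \sum_i `|w 0 i|.
Proof.
move=> oU fC1 Ux e0.
have [d0 d0_gt0 d0U] := open_cube oU Ux.
have /choice[dd ddP] : forall i, exists d : R, 0 < d /\
    forall y, (forall j, `|y 0 j - x 0 j| < d) ->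
      `|partial f i y - partial f i x| < e.
  move=> i; have [_ pc] := fC1 i x Ux.
  by have [d ? ?] := continuous_cube pc e0; exists d.
pose d := \big[Num.min/d0]_i dd i.
have d_gt0 : 0 < d.
  apply: (big_ind (fun r => 0 < r)) => [//|a b a0 b0|i _]; last exact: (ddP i).1.
  by rewrite lt_min a0.
have dd0 : d <= d0 by rewrite /d; exact: bigmin_le_id.
have ddi i : d <= dd i by rewrite /d; exact: bigmin_le.
exists d => // w wd; split.
  by apply: d0U => i; rewrite !mxE addrAC subrr add0r (lt_le_trans (wd i)).
pose p (k : nat) : 'rV[R]_n := \row_i (if (i < k)%N then w 0 i else 0).
have pd k j : `|p k 0 j| < d by rewrite mxE; case: ifP => // _; rewrite normr0.
have p0 : p 0%N = 0 by apply/rowP => i; rewrite !mxE.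
have pn : p n = w by apply/rowP => i; rewrite !mxE ltn_ord.
have pS (i : 'I_n) : p i.+1 = p i + w 0 i *: delta_mx 0 i.
  apply/rowP => j; rewrite !mxE eqxx/= ltnS leq_eqVlt.
  have [->|ji] := eqVneq j i; first by rewrite eqxx ltnn mulr1 add0r.
  have -> : (val j == val i) = false by apply/negbTE.
  by rewrite /= mulr0 addr0.
have step (i : 'I_n) :
    `|f (x + p i.+1) - f (x + p i) - grad f x 0 i * w 0 i| <= e * `|w 0 i|.
  have [] := @mvt_ball (fun h => f (x + p i + h *: delta_mx 0 i))
      (fun h => partial f i (x + p i + h *: delta_mx 0 i)) d (w 0 i) => //.
    move=> s sd; apply: is_derive_line; apply: (fC1 i _ _).1; apply: d0U => j.
    rewrite !mxE eqxx/= -addrA addrAC subrr add0r.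
    have [->|ji] := eqVneq j i.
      by rewrite ltnn add0r mulr1; exact: lt_le_trans sd dd0.
    by rewrite mulr0 addr0; have := pd i j; rewrite mxE => /lt_le_trans; apply.
  move=> s sw; rewrite scale0r addr0 -addrA -pS => ->.
  rewrite mxE -mulrBl normrM ler_wpM2r// ltW//; apply: (ddP i).2 => j.
  rewrite !mxE eqxx/= -addrA addrAC subrr add0r; apply: lt_le_trans (ddi i).
  have [->|ji] := eqVneq j i.
    by rewrite ltnn add0r mulr1; exact: le_lt_trans sw (wd i).
  by rewrite mulr0 addr0; have := pd i j; rewrite mxE.
have -> : f (x + w) - f x = \sum_(i < n) (f (x + p i.+1) - f (x + p i)).
  rewrite -(big_mkord xpredT (fun k => f (x + p k.+1) - f (x + p k))).
  by rewrite telescope_sumr// pn p0 addr0.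
rewrite /dotv -sumrB mulr_sumr; apply: le_trans (ler_norm_sum _ _ _) _.
exact: ler_sum.
Qed.

Lemma C1_is_derive_line U f x v (s : R) : open U -> C1_on U f ->
  U (x + s *: v) ->
  is_derive s (1 : R) (fun h : R => f (x + h *: v))
    (dotv (grad f (x + s *: v)) v).
Proof.
move=> oU fC1 Ux; set y := x + s *: v.
have S0 : 0 < 1 + \sum_i `|v 0 i| by rewrite ltr_pwDl// sumr_ge0.
have C : (fun h : R => h^-1 *: ((fun k : R => f (x + k *: v)) (h *: (1 : R) + s)
           - f (x + s *: v))) @ (0 : R)^' --> dotv (grad f y) v.
  apply/cvgrPdist_le => e e0.
  have [d d0 dw] := C1_expansion oU fC1 Ux (divr_gt0 e0 S0).
  exists (d / (1 + \sum_i `|v 0 i|)); first exact: divr_gt0.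
  move=> h; rewrite /ball_/= sub0r normrN ltr_pdivlMr// => hd h0.
  have -> : x + (h *: (1 : R) + s) *: v = y + h *: v.
    by rewrite [h *: 1]mulr1 scalerDl addrCA addrC -addrA (addrC (s *: v)).
  have [|_ ] := dw (h *: v).
    move=> i; rewrite mxE normrM; apply: le_lt_trans hd.
    rewrite ler_wpM2l// (bigD1 i)//= addrCA lerDl addr_ge0//; exact: sumr_ge0.
  rewrite dotvZr -/y => E.
  have -> : dotv (grad f y) v - h^-1 *: (f (y + h *: v) - f y) =
      - (h^-1 * (f (y + h *: v) - f y - h * dotv (grad f y) v)).
    by rewrite [_ *: _]/(_ * _) mulrBr mulKf// opprB.
  rewrite normrN normrM normfV ler_pdivrMl ?normr_gt0//; apply: le_trans E _.
  have -> : \sum_i `|(h *: v) 0 i| = `|h| * \sum_i `|v 0 i|.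
    by rewrite mulr_sumr; apply: eq_bigr => i _; rewrite mxE normrM.
  rewrite mulrCA ler_wpM2l// mulrAC ler_pdivrMr//.
  by rewrite ler_wpM2l ?(ltW e0)// lerDr.
by apply: DeriveDef; [apply/cvg_ex; eexists; exact: C | apply/cvg_lim].
Qed.

(** Second-order necessary condition in one variable, with a quadratic instead
of a constant as the touching lower bound. *)
Lemma second_derivative_ge (g dg : R -> R) (d L a b : R) : 0 < d ->
  (forall s, `|s| < d -> is_derive s (1 : R) g (dg s)) ->
  is_derive (0 : R) (1 : R) dg L ->
  (forall s, `|s| < d -> g 0 + a * s + b * s ^+ 2 <= g s) -> 2 * b <= L.
Proof.
move=> d0 gd dgL gmin; rewrite leNgt; apply/negP => Lb.
pose h s := g s - a * s - b * s ^+ 2.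
pose dh s := dg s - a - 2 * b * s.
have hd s : `|s| < d -> is_derive s (1 : R) h (dh s).
  move=> /gd gs; have -> : h = g - a *: id - b *: (id ^+ 2).
    by apply/funext => r; rewrite /h !fctE.
  apply: is_derive_eq; rewrite /dh /GRing.scale/=; ring.
have hmin s : `|s| < d -> h 0 <= h s.
  by move=> /gmin; rewrite /h expr0n/= !mulr0 !subr0 => *; lra.
have dh0 : dh 0 = 0.
  have h0 : is_derive (0 : R) (1 : R) h 0.
    apply: (@derive1_at_min _ h (- d) d 0).
    - by lra.
    - by move=> t; rewrite in_itv/= -ltr_norml => /hd [].
    - by rewrite in_itv/=; apply/andP; split; lra.
    - by move=> t; rewrite in_itv/= -ltr_norml => /hmin.
  have z_d : `|0 : R| < d by rewrite normr0.
  by have [_ <-] := hd 0 z_d; have [_ ->] := h0.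
have dhL : is_derive (0 : R) (1 : R) dh (L - 2 * b).
  have -> : dh = dg - cst a - (2 * b) *: id.
    by apply/funext => r; rewrite /dh !fctE.
  by apply: is_derive_eq; rewrite /GRing.scale/=; ring.
have [dcv dE] := dhL.
have : (fun k : R => k^-1 *: (dh (k *: (1 : R) + 0) - dh 0)) @ (0 : R)^' -->
    (L - 2 * b).
  by rewrite -dE; exact: dcv.
have c0 : 0 < 2 * b - L by lra.
move=> /cvgrPdist_lt/(_ _ c0) [r /= r0 rP].
have neg s : 0 < s -> s < r -> dh s < 0.
  move=> s0 sr; have /= := rP s.
  rewrite sub0r normrN gtr0_norm// => /(_ sr); rewrite gt_eqF// => /(_ isT).
  rewrite dh0 subr0 addr0 [s *: 1]mulr1 [_ *: _]/(_ * _) ltr_norml => /andP[+ _].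
  by rewrite opprB ltrDl oppr_gt0 pmulr_rlt0// invr_gt0.
have [m [m0 mr mdd]] := exists_below r0 d0.
have [c] : exists2 c, c \in `]0, m[%R & h m - h 0 = dh c * (m - 0).
  apply: MVT; first exact: m0.
    by move=> s; rewrite in_itv/= => sm; apply: hd; rewrite gtr0_norm; lra.
  apply: derivable_within_continuous => s; rewrite in_itv/= => sm.
  have /hd [] // : `|s| < d by rewrite ger0_norm; lra.
rewrite in_itv/= subr0 => cm E.
have : h 0 <= h m by apply: hmin; rewrite gtr0_norm.
rewrite -subr_ge0 E; apply/negP; rewrite -ltNge pmulr_llt0//.
by apply: neg; lra.
Qed.

Definition qform (M : 'M[R]_n) v : R := \sum_i \sum_j v 0 i * M i j * v 0 j.

Lemma C2_line U f x v : open U -> C2_on U f -> U x ->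
  exists2 d : R, 0 < d & (forall s : R, `|s| < d -> U (x + s *: v)) /\
    (forall s, `|s| < d ->
      is_derive s (1 : R) (fun h : R => f (x + h *: v))
        (dotv (grad f (x + s *: v)) v)) /\
    is_derive (0 : R) (1 : R) (fun s : R => dotv (grad f (x + s *: v)) v)
      (qform (hessian f x) v).
Proof.
move=> oU [fC1 fC2] Ux; have [d d0 dU] := open_cube oU Ux.
have [e e0 eP] := line_in_cube x v d0.
have Us (s : R) : `|s| < e -> U (x + s *: v) by move=> /eP/dU.
exists e => //; split=> //; split; first by move=> s sd; apply: C1_is_derive_line oU fC1 (Us _ sd).
have -> : (fun s : R => dotv (grad f (x + s *: v)) v) =
    \sum_i (fun s : R => v 0 i *: partial f i (x + s *: v)).
  apply/funext => s; rewrite fct_sumE; apply: eq_bigr => i _.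
  by rewrite mxE mulrC.
have -> : qform (hessian f x) v =
    \sum_i v 0 i *: dotv (grad (partial f i) x) v.
  apply: eq_bigr => i _; rewrite /dotv scaler_sumr; apply: eq_bigr => j _.
  by rewrite !mxE -mulrA.
apply: is_derive_sum => i; apply: is_deriveZ.
have -> : dotv (grad (partial f i) x) v =
   dotv (grad (partial f i) (x + (0 : R) *: v)) v by rewrite scale0r addr0.
by apply: C1_is_derive_line oU (fC2 i) _; rewrite scale0r addr0.
Qed.

Lemma hessian_ge U f x v (d a b : R) : open U -> C2_on U f -> U x -> 0 < d ->
  (forall s : R, `|s| < d -> f x + a * s + b * s ^+ 2 <= f (x + s *: v)) ->
  2 * b <= qform (hessian f x) v.
Proof.
move=> oU fC2 Ux d0 fmin; have [d1 d10 [_ [D1 D2]]] := C2_line v oU fC2 Ux.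
have dd : 0 < Num.min d d1 by rewrite lt_min d0.
apply: (@second_derivative_ge (fun s => f (x + s *: v)) _ _ _ a b dd _ D2).
  by move=> s; rewrite lt_min => /andP[_ /D1].
move=> s; rewrite lt_min => /andP[/fmin + _].
by rewrite scale0r addr0; apply.
Qed.

Lemma hessian_le U f x v (d a b : R) : open U -> C2_on U f -> U x -> 0 < d ->
  (forall s : R, `|s| < d -> f (x + s *: v) <= f x + a * s + b * s ^+ 2) ->
  qform (hessian f x) v <= 2 * b.
Proof.
move=> oU fC2 Ux d0 fmax; have [d1 d10 [_ [D1 D2]]] := C2_line v oU fC2 Ux.
have dd : 0 < Num.min d d1 by rewrite lt_min d0.
have := @second_derivative_ge (fun s => - f (x + s *: v))
  (fun s => - dotv (grad f (x + s *: v)) v) _ (- qform (hessian f x) v)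
  (- a) (- b) dd.
rewrite mulrN lerN2; apply.
- by move=> s; rewrite lt_min => /andP[_ /D1] D1s; exact: (is_deriveN D1s).
- move=> s; rewrite lt_min => /andP[/fmax + _].
  by rewrite scale0r addr0 => *; lra.
Qed.

(** The second difference is symmetric in [i] and [j], while two applications of the
mean value theorem compare it with a mixed derivative, in the order chosen; hence
the symmetry of the Hessian. *)
Lemma second_difference U f x (e : R) (i j : 'I_n) :
  open U -> C2_on U f -> U x -> 0 < e ->
  exists2 d : R, 0 < d & forall s : R, 0 < s -> s < d ->
   `|(f (x + s *: delta_mx 0 i + s *: delta_mx 0 j) - f (x + s *: delta_mx 0 i)
      - f (x + s *: delta_mx 0 j) + f x) / s ^+ 2
     - hessian f x i j| < e.
Proof.
move=> oU [fC1 fC2] Ux e0; have [d0 d00 d0U] := open_cube oU Ux.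
have [d1 d10 d1c] := continuous_cube (fC2 i j x Ux).2 e0.
have [d [dgt0 dd0 dd1]] : exists d, [/\ 0 < d, 2 * d <= d0 & 2 * d <= d1].
  by have [m [m0 ma mb]] := exists_below d00 d10; exists (m / 2); split; lra.
have near (a b : R) k : `|a| < d -> `|b| < d ->
    `|(x + a *: delta_mx 0 i + b *: delta_mx 0 j) 0 k - x 0 k| < 2 * d.
  move=> ad bd; rewrite !mxE !eqxx/= -!addrA addrC -!addrA addNr addr0.
  have : `|a * (k == i)%:R + b * (k == j)%:R| <= `|a| + `|b|.
    apply: le_trans (ler_normD _ _) _; rewrite !normrM !normr_nat.
    by apply: lerD; rewrite ler_piMr//; case: eqP.
  by move=> /le_lt_trans; apply; lra.
have inU (a b : R) : `|a| < d -> `|b| < d ->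
    U (x + a *: delta_mx 0 i + b *: delta_mx 0 j).
  by move=> ad bd; apply: d0U => k; apply: lt_le_trans dd0; exact: near.
exists d => // s s0 sd.
have sd' : `|s| < d by rewrite gtr0_norm.
have z_d : `|0 : R| < d by rewrite normr0.
pose F (h : R) := f (x + s *: delta_mx 0 j + h *: delta_mx 0 i)
  - f (x + h *: delta_mx 0 i).
pose dF (h : R) := partial f i (x + s *: delta_mx 0 j + h *: delta_mx 0 i)
  - partial f i (x + h *: delta_mx 0 i).
have FdF h : `|h| < d -> is_derive h (1 : R) F (dF h).
  move=> hd; apply: is_deriveB; apply: is_derive_line; apply: (fC1 i _ _).1.
    by rewrite addrAC; exact: inU.
  by have := inU h 0 hd z_d; rewrite scale0r addr0.
have [h hs E2] := mvt_ball FdF sd'.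
pose P (k : R) := partial f i (x + h *: delta_mx 0 i + k *: delta_mx 0 j).
pose dP (k : R) := partial (partial f i) j
  (x + h *: delta_mx 0 i + k *: delta_mx 0 j).
have PdP k : `|k| < d -> is_derive k (1 : R) P (dP k).
  move=> kd; apply: is_derive_line; apply: (fC2 i j _ _).1; apply: inU => //.
  exact: le_lt_trans hs sd'.
have [k ks E1] := mvt_ball PdP sd'.
move: E1 E2; rewrite /P /dP /F /dF !scale0r !addr0 => E1 E2.
have -> : f (x + s *: delta_mx 0 i + s *: delta_mx 0 j) -
    f (x + s *: delta_mx 0 i) - f (x + s *: delta_mx 0 j) + f x =
    partial (partial f i) j (x + h *: delta_mx 0 i + k *: delta_mx 0 j) * s ^+ 2.
  rewrite expr2 mulrA -E1; move: E2.
  rewrite (addrAC x (h *: _)) => <-.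
  by rewrite (addrAC x (s *: delta_mx 0 j)); ring.
rewrite mulfK ?expf_neq0 ?gt_eqF// mxE; apply: d1c => l.
by apply: lt_le_trans dd1; apply: near; apply: le_lt_trans sd'.
Qed.

Lemma hessian_sym U f x : open U -> C2_on U f -> U x ->
  forall i j, hessian f x i j = hessian f x j i.
Proof.
move=> oU fC2 Ux i j; apply/eqP; rewrite -subr_eq0 -normr_le0.
apply/ler_addgt0Pr => e e0; rewrite add0r.
have e20 : 0 < e / 2 by lra.
have [d1 d10 h1] := second_difference i j oU fC2 Ux e20.
have [d2 d20 h2] := second_difference j i oU fC2 Ux e20.
have [s [s0 sd1 sd2]] := exists_below d10 d20.
have := h1 s s0 sd1; have := h2 s s0 sd2.
rewrite (addrAC x (s *: delta_mx 0 j)).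
set D1 := f _ - f _ - f _ + f _; set D2 := f _ - f _ - f _ + f _.
have -> : D1 = D2 by rewrite /D1 /D2; ring.
set q := _ / _; move=> H2 H1.
have -> : hessian f x i j - hessian f x j i =
  (q - hessian f x j i) - (q - hessian f x i j) by ring.
by apply: le_trans (ler_normB _ _) _; lra.
Qed.

End calculus_lemmas.

(** * Determinants and quadratic forms *)

Section determinants.
Context {R : realType}.

Lemma qformE n (M : 'M[R]_n) (v : 'rV[R]_n) : qform M v = (v *m M *m v^T) 0 0.
Proof.
rewrite /qform mxE; under [RHS]eq_bigr do rewrite mxE mulr_suml.
by rewrite exchange_big; apply: eq_bigr => j _; apply: eq_bigr => i _; rewrite !mxE.
Qed.

Lemma qformD n (M N : 'M[R]_n) v : qform (M + N) v = qform M v + qform N v.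
Proof. by rewrite !qformE mulmxDr mulmxDl mxE. Qed.

Lemma qformZ n (a : R) (M : 'M[R]_n) v : qform (a *: M) v = a * qform M v.
Proof. by rewrite !qformE -scalemxAr -scalemxAl mxE. Qed.

Lemma qform_tensor n (u v : 'rV[R]_n) : qform (u^T *m u) v = dotv u v ^+ 2.
Proof.
rewrite qformE !mulmxA -mulmxA mxE big_ord1 expr2; congr (_ * _).
  by rewrite dotvC mxE; apply: eq_bigr => i _; rewrite !mxE.
by rewrite mxE; apply: eq_bigr => i _; rewrite !mxE.
Qed.

Lemma qform1 n (v : 'rV[R]_n) : qform 1%:M v = dotv v v.
Proof. by rewrite qformE mulmx1 mxE; apply: eq_bigr => i _; rewrite !mxE. Qed.

Lemma qform_gram m n (E : 'M[R]_(n, m)) v :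
  qform (E *m E^T) v = \sum_k (v *m E) 0 k ^+ 2.
Proof.
rewrite qformE mulmxA -mulmxA -trmx_mul mxE.
by apply: eq_bigr => k _; rewrite [X in _ * X]mxE expr2.
Qed.

Lemma det_schur n (a : R) (b : 'rV[R]_n) (c : 'cV[R]_n) (D : 'M[R]_n) : a != 0 ->
  \det (block_mx a%:M b c D) = a * \det (D - a^-1 *: (c *m b)).
Proof.
move=> a0.
have -> : block_mx a%:M b c D =
    block_mx 1%:M 0 (a^-1 *: c) 1%:M *m block_mx a%:M b 0 (D - a^-1 *: (c *m b)).
  rewrite mulmx_block !mul1mx !mul0mx !addr0 -!scalemxAl; congr block_mx.
  - by rewrite mul_mx_scalar scalerA mulVf// scale1r.
  - by rewrite addrC subrK.
by rewrite det_mulmx det_lblock det_ublock !det1 !mul1r det_scalar1.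
Qed.

Lemma qform_block n (a : R) (b : 'rV[R]_n) (c : 'cV[R]_n) (D : 'M[R]_n)
    (s : R) (w : 'rV[R]_n) :
  qform (block_mx a%:M b c D) (row_mx s%:M w) =
  a * s ^+ 2 + s * (dotv b w + dotv c^T w) + qform D w.
Proof.
have addE (A B : 'M[R]_1) : (A + B) 0 0 = A 0 0 + B 0 0 by rewrite mxE.
have sclE (k : R) (A : 'M[R]_1) : (k *: A) 0 0 = k * A 0 0 by rewrite mxE.
rewrite !qformE mul_row_block tr_row_mx mul_row_col tr_scalar_mx.
rewrite !mul_scalar_mx !mul_mx_scalar mulmxDl -!scalemxAl !(addE, sclE).
have -> : (w *m c) 0 0 = dotv c^T w.
  by rewrite mxE; apply: eq_bigr => i _; rewrite !mxE mulrC.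
have -> : (b *m w^T) 0 0 = dotv b w.
  by rewrite mxE; apply: eq_bigr => i _; rewrite !mxE.
by rewrite mxE eqxx mulr1n; ring.
Qed.

(** By induction on Schur complements: that of [H] is the minimum of the form of
[H] over the first variable, whereas that of [M] dominates the minimum of the form
of [M], by the inequality between the arithmetic and geometric means. Hence the
larger matrix may be any square matrix. *)
Lemma det_form_le n (H M : 'M[R]_n) :
  (forall i j, H i j = H j i) -> (forall v, v != 0 -> 0 < qform H v) ->
  (forall v, qform H v <= qform M v) -> 0 < \det H <= \det M.
Proof.
elim: n H M => [|n IH] H M Hsym Hpos HM; first by rewrite !det_mx00 ltr01 lexx.
pose blk (A : 'M[R]_(1 + n)) :=
  block_mx (A 0 0)%:M (ursubmx A) (dlsubmx A) (drsubmx A).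
have blkE (A : 'M[R]_(1 + n)) : A = blk A.
  rewrite -[LHS]submxK /blk; congr block_mx.
  rewrite [LHS]mx11_scalar; congr (_%:M); rewrite !mxE.
  by congr (A _ _); apply: val_inj.
pose bH := ursubmx (H : 'M[R]_(1 + n)); pose DH := drsubmx (H : 'M[R]_(1 + n)).
pose cM := dlsubmx (M : 'M[R]_(1 + n)); pose DM := drsubmx (M : 'M[R]_(1 + n)).
pose bM := ursubmx (M : 'M[R]_(1 + n)).
have cHE : dlsubmx (H : 'M[R]_(1 + n)) = bH^T.
  by apply/matrixP => i j; rewrite !mxE; exact: Hsym.
have qH s w : qform H (row_mx (s%:M : 'M[R]_1) w : 'rV_(1 + n)) =
    H 0 0 * s ^+ 2 + 2 * s * dotv bH w + qform DH w.
  rewrite {1}(blkE H) /blk qform_block cHE trmxK -/bH -/DH.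
  by congr (_ + _); ring.
have qM s w : qform M (row_mx (s%:M : 'M[R]_1) w : 'rV_(1 + n)) =
    M 0 0 * s ^+ 2 + s * (dotv bM w + dotv cM^T w) + qform DM w.
  by rewrite {1}(blkE M) /blk qform_block.
have row_neq0 s (w : 'rV_n) : (s != 0) || (w != 0) ->
    row_mx (s%:M : 'M[R]_1) w != 0 :> 'rV_(1 + n).
  apply: contraL => /eqP; rewrite -row_mx0 => /eq_row_mx[/matrixP/(_ 0 0) + ->].
  by rewrite !mxE eqxx mulr1n => ->; rewrite !eqxx.
have H00 : 0 < H 0 0.
  have := Hpos _ (row_neq0 1 0 _); rewrite oner_neq0 => /(_ isT).
  rewrite qH dotv0 expr1n !mulr1 mulr0 addr0 qformE mul0mx mul0mx mxE addr0.
  by [].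
have M00 : H 0 0 <= M 0 0.
  have := HM (row_mx (1%:M : 'M[R]_1) 0 : 'rV_(1 + n)).
  rewrite qH qM !dotv0 expr1n !mulr1 addr0 mulr0 !qformE !mul0mx !mxE.
  by rewrite mulr0 !addr0.
have M00_gt0 : 0 < M 0 0 by apply: lt_le_trans M00.
have SH w : qform (DH - (H 0 0)^-1 *: (bH^T *m bH)) w =
    qform DH w - (H 0 0)^-1 * dotv bH w ^+ 2.
  by rewrite -scaleNr qformD qformZ qform_tensor mulNr.
have SM w : qform (DM - (M 0 0)^-1 *: (cM *m bM)) w =
    qform DM w - (M 0 0)^-1 * (dotv cM^T w * dotv bM w).
  rewrite -scaleNr qformD qformZ mulNr; congr (_ - _ * _).
  rewrite qformE !mulmxA -mulmxA mxE big_ord1; congr (_ * _).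
    by rewrite mxE; apply: eq_bigr => i _; rewrite !mxE mulrC.
  by rewrite mxE; apply: eq_bigr => i _; rewrite !mxE.
have SH_min s w : qform (DH - (H 0 0)^-1 *: (bH^T *m bH)) w <=
    qform H (row_mx (s%:M : 'M[R]_1) w : 'rV_(1 + n)).
  rewrite SH qH -subr_ge0.
  have -> : H 0 0 * s ^+ 2 + 2 * s * dotv bH w + qform DH w -
      (qform DH w - (H 0 0)^-1 * dotv bH w ^+ 2) =
      H 0 0 * (s + (H 0 0)^-1 * dotv bH w) ^+ 2.
    by field; rewrite gt_eqF.
  by rewrite mulr_ge0 ?sqr_ge0// ltW.
have /andP[dS0 dS] : 0 < \det (DH - (H 0 0)^-1 *: (bH^T *m bH)) <=
    \det (DM - (M 0 0)^-1 *: (cM *m bM)).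
  apply: IH.
  - move=> i j; rewrite !mxE !big_ord1 !mxE; congr (_ - _ * _); last exact: mulrC.
    exact: Hsym.
  - move=> w w0; have := Hpos _ (row_neq0 (- (H 0 0)^-1 * dotv bH w) w _).
    rewrite w0 orbT => /(_ isT); rewrite qH SH.
    suff -> : H 0 0 * (- (H 0 0)^-1 * dotv bH w) ^+ 2 +
        2 * (- (H 0 0)^-1 * dotv bH w) * dotv bH w + qform DH w =
        qform DH w - (H 0 0)^-1 * dotv bH w ^+ 2 by [].
    by field; rewrite gt_eqF.
  - move=> w; apply: le_trans (SH_min (- (dotv bM w + dotv cM^T w) / (2 * M 0 0)) w) _.
    apply: le_trans (HM _) _; rewrite qM SM -subr_ge0.
    set p := dotv bM w; set q := dotv cM^T w.
    suff -> : qform DM w - (M 0 0)^-1 * (q * p) - (M 0 0 * (- (p + q) / (2 * M 0 0)) ^+ 2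
        + - (p + q) / (2 * M 0 0) * (p + q) + qform DM w) =
        (M 0 0)^-1 * ((p - q) / 2) ^+ 2.
      by rewrite mulr_ge0 ?sqr_ge0// invr_ge0 ltW.
    by field; rewrite gt_eqF.
have dH : \det H = H 0 0 * \det (DH - (H 0 0)^-1 *: (bH^T *m bH)).
  by rewrite {1}(blkE H) /blk cHE det_schur ?gt_eqF.
have dM : \det M = M 0 0 * \det (DM - (M 0 0)^-1 *: (cM *m bM)).
  by rewrite {1}(blkE M) /blk det_schur ?gt_eqF.
rewrite dH dM mulr_gt0//=; apply: ler_pM => //; exact: ltW.
Qed.

(** A null vector of a nonnegative form is in the kernel of the matrix, by
perturbing it in the direction of its image. *)
Lemma psd_det_pos n (M : 'M[R]_n) : (forall i j, M i j = M j i) ->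
  (forall v, 0 <= qform M v) -> \det M != 0 ->
  forall v, v != 0 -> 0 < qform M v.
Proof.
move=> Msym Mge0 detM v v0; rewrite lt_neqAle Mge0 andbT eq_sym.
apply: contra v0 => /eqP qv0; set w := v *m M.
have E s : qform M (v + s *: w) = 2 * s * dotv w w + s ^+ 2 * qform M w.
  have MT : M^T = M by apply/matrixP => i j; rewrite mxE Msym.
  have addE (A B : 'M[R]_1) : (A + B) 0 0 = A 0 0 + B 0 0 by rewrite mxE.
  have sclE (k : R) (A : 'M[R]_1) : (k *: A) 0 0 = k * A 0 0 by rewrite mxE.
  have wwE : (w *m w^T) 0 0 = dotv w w.
    by rewrite mxE; apply: eq_bigr => i _; rewrite [X in _ * X]mxE.
  rewrite !qformE linearD linearZ/= mulmxDl mulmxDl !mulmxDr -!scalemxAl -!scalemxAr.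
  rewrite !(addE, sclE) -!qformE qv0 -/w wwE.
  have -> : w *m M *m v^T = w *m w^T by rewrite -mulmxA -{1}MT -trmx_mul.
  by rewrite wwE; ring.
have ww : dotv w w = 0.
  have q0 := Mge0 w; pose s := - dotv w w / (1 + qform M w).
  have := Mge0 (v + s *: w); rewrite E.
  have -> : 2 * s * dotv w w + s ^+ 2 * qform M w =
      - (dotv w w / (1 + qform M w)) ^+ 2 * (2 + qform M w).
    by rewrite /s; field; rewrite gt_eqF//; lra.
  rewrite mulNr oppr_ge0 pmulr_lle0; last by lra.
  move=> h; have /eqP : (dotv w w / (1 + qform M w)) ^+ 2 = 0.
    by apply/eqP; rewrite eq_le h sqr_ge0.
  rewrite sqrf_eq0 mulf_eq0 invr_eq0 => /orP[/eqP//|/eqP]; lra.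
have /dotv_eq0 w0 := ww.
have Mu : M \in unitmx by rewrite unitmxE unitfE.
by rewrite -(mulmxK Mu v) -/w w0 mul0mx.
Qed.

(** Both sides are the determinant of one bordered matrix, whose two Schur
complements are the matrix on the left and a scalar. *)
Lemma det_scalar_add_tensor n (a b : R) (u : 'rV[R]_n) : a != 0 ->
  \det (a%:M + b *: (u^T *m u)) = a ^+ n * (1 + b / a * dotv u u).
Proof.
move=> a0.
have udot : u *m u^T = (dotv u u)%:M.
  rewrite [LHS]mx11_scalar; congr (_%:M); rewrite mxE.
  by apply: eq_bigr => i _; rewrite !mxE.
pose B := block_mx (1%:M : 'M[R]_1) (- u) (b *: u^T) a%:M.
have -> : \det (a%:M + b *: (u^T *m u)) = \det B.
  rewrite /B det_schur ?oner_neq0// mul1r invr1 scale1r mulmxN opprK.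
  by rewrite scalemxAl.
have -> : B = block_mx (1 + b / a * dotv u u)%:M (- a^-1 *: u) 0 1%:M *m
    block_mx 1%:M 0 (b *: u^T) a%:M.
  rewrite mulmx_block !mul1mx !mul0mx !mulmx0 !mulmx1 !add0r /B; congr block_mx.
    rewrite -scalemxAl -scalemxAr scalerA udot scale_scalar_mx -raddfD/=.
    by congr (_%:M); field.
  by rewrite mul_mx_scalar scalerA mulrN mulfV// scaleN1r.
by rewrite det_mulmx det_ublock det_lblock !det1 det_scalar1 det_scalar mulr1 mul1r mulrC.
Qed.

End determinants.

(** * Lebesgue measure of triangular boxes *)

Section triangular_boxes.
Context {R : realType}.
Implicit Types (x y : nat -> R) (g : nat -> (nat -> R) -> R) (w : nat -> R).

(** Image of a box under a triangular map of R^m with unit Jacobian: each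
coordinate ranges over an interval of fixed length whose centre depends on the
previous coordinates only. *)
Definition tri_box (m : nat) g w x : Prop :=
  forall i, (i < m)%N -> `|x i - g i x| <= w i.

Definition upd x m (t : R) : nat -> R := fun i => if i == m then t else x i.

Lemma updE x m t : upd x m t m = t.
Proof. by rewrite /upd eqxx. Qed.

Lemma upd_lt x m t i : (i < m)%N -> upd x m t i = x i.
Proof. by rewrite /upd => im; rewrite ltn_eqF. Qed.

Lemma prod_upd (F : R -> R -> R) x y m s t :
  \prod_(i < m.+1) F (upd x m s i) (upd y m t i) =
  (\prod_(i < m) F (x i) (y i)) * F s t.
Proof.
rewrite big_ord_recr/= !updE; congr (_ * _).
by apply: eq_bigr => i _; rewrite !upd_lt.
Qed.

(** The pieces of length [h] cover the interval: take the last one that starts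
before [t]. *)
Lemma nat_piece (N : nat) (l h t : R) : (0 < N)%N -> 0 < h ->
  l <= t <= l + N%:R * h ->
  exists2 k : 'I_N, true & l + k%:R * h <= t <= l + k.+1%:R * h.
Proof.
move=> N0 h0 /andP[lt tN].
have [k /andP[k1 k2]] : exists k, (l + k%:R * h <= t) && (k < N)%N.
  by exists 0%N; rewrite mul0r addr0 lt N0.
have ub (j : nat) : (l + j%:R * h <= t) && (j < N)%N -> (j <= N)%N.
  by move=> /andP[_ /ltnW].
have exk : exists j, (l + j%:R * h <= t) && (j < N)%N by exists k; rewrite k1 k2.
case: (ex_maxnP exk ub) => j /andP[j1 j2] jmax.
exists (Ordinal j2) => //=; rewrite j1/=.
have [->//|jN] := eqVneq j.+1 N.
rewrite leNgt; apply/negP => tj.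
have := jmax j.+1; rewrite (ltW tj)/= ltn_neqAle jN j2 => /(_ isT).
by rewrite ltnn.
Qed.

(** The set is cut into boxes so small that the centre of the next coordinate
hardly varies on each of them, which costs a bounded factor only. *)
Lemma tri_box_cover m g w (L : R) : (forall i, 0 < w i) -> 0 < L ->
  (forall i x y (d : R), 0 <= d -> (forall j, (j < i)%N -> `|x j - y j| <= d) ->
     `|g i x - g i y| <= L * d) ->
  forall d : R, 0 < d -> exists (I : finType) (A B : I -> nat -> R),
    [/\ forall k i, (i < m)%N -> A k i <= B k i <= A k i + d,
        forall x, tri_box m g w x -> exists k, forall i, (i < m)%N ->
          A k i <= x i <= B k i &
        \sum_k \prod_(i < m) (B k i - A k i) <= \prod_(i < m) (4 * w i)].
Proof.
move=> w0 L0 gL; elim: m => [|m IH] d d0.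
  exists unit, (fun _ _ => 0), (fun _ _ => 0); split=> [//|x _|].
    by exists tt.
  rewrite (eq_bigr (fun=> 1)); last by move=> ? _; rewrite big_ord0.
  by rewrite big_ord0 sumr_const card_unit.
pose d' := Num.min d (w m / L).
have d'0 : 0 < d' by rewrite lt_min d0 divr_gt0.
have [I [A [B [AB cov vol]]]] := IH d' d'0.
have [N Nd] : exists N : nat, 4 * w m / d < N.+1%:R.
  exists (Num.truncn (4 * w m / d)); exact: truncnS_gt.
pose h := 4 * w m / N.+1%:R.
have w4 : 0 < 4 * w m by rewrite mulr_gt0.
have h0 : 0 < h by rewrite divr_gt0// ltr0n.
have hd : h <= d.
  by rewrite /h ler_pdivrMr ?ltr0n// (mulrC d) -ler_pdivrMr// ltW.
have Nh : N.+1%:R * h = 4 * w m by rewrite /h mulrC divfK// pnatr_eq0.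
pose lo (k : I) := g m (A k) - 2 * w m.
exists ((I * 'I_N.+1)%type : finType),
  (fun p : I * 'I_N.+1 => upd (A p.1) m (lo p.1 + p.2%:R * h)),
  (fun p : I * 'I_N.+1 => upd (B p.1) m (lo p.1 + p.2.+1%:R * h)); split.
- move=> [k q] i; rewrite ltnS leq_eqVlt => /orP[/eqP->|im] /=.
    rewrite !updE -natr1 mulrDl mul1r.
    by apply/andP; split; lra.
  rewrite !upd_lt//; have /andP[-> /= H] := AB k i im.
  by apply: le_trans H _; rewrite lerD2l ge_min lexx.
- move=> x xT; have [|k xk] := cov x.
    by move=> i im; apply: xT; exact: ltnW.
  have gx : `|g m x - g m (A k)| <= w m.
    apply: le_trans (gL _ _ _ d' (ltW d'0) _) _.
      move=> j jm; have /andP[? ?] := xk j jm; have /andP[? ?] := AB k j jm.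
      by rewrite ger0_norm; lra.
    by rewrite mulrC -ler_pdivlMr// ge_min lexx orbT.
  have xm := xT m (ltnSn m).
  have [] := @nat_piece N.+1 (lo k) h (x m) _ h0; rewrite ?Nh//.
    by move: gx xm; rewrite /lo !ler_norml; lra.
  move=> q _ xq; exists (k, q) => i; rewrite ltnS leq_eqVlt => /orP[/eqP->|im] /=.
    by rewrite !updE.
  by rewrite !upd_lt// xk.
- rewrite big_ord_recr/= -(pair_bigA _ (fun k (q : 'I_N.+1) => \prod_(i < m.+1)
    (upd (B k) m (lo k + q.+1%:R * h) i - upd (A k) m (lo k + q%:R * h) i)))/=.
  have E k : \sum_(q < N.+1) \prod_(i < m.+1)
    (upd (B k) m (lo k + q.+1%:R * h) i - upd (A k) m (lo k + q%:R * h) i) =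
    (\prod_(i < m) (B k i - A k i)) * (4 * w m).
    rewrite (eq_bigr (fun=> (\prod_(i < m) (B k i - A k i)) * h)).
      by rewrite sumr_const card_ord -mulrnAr -mulr_natl Nh.
    move=> q _; rewrite (prod_upd (fun b a => b - a)); congr (_ * _).
    by rewrite -natr1; ring.
  under eq_bigr do rewrite E.
  by rewrite -mulr_suml ler_pM2r.
Qed.

Lemma integral_indic_series (d a b : nat -> R) (l h : R) :
  (forall k, 0 <= d k) -> (forall k, a k <= b k) -> l <= h ->
  (forall t, l <= t <= h ->
     (1 <= \sum_(k <oo) (d k * (a k <= t <= b k)%R%:R)%:E)%E) ->
  ((h - l)%:E <= \sum_(k <oo) (d k * (b k - a k))%:E)%E.
Proof.
move=> d0 ab lh cov.
have itvE (c e : R) : c <= e ->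
    (\int[@lebesgue_measure R]_t (\1_(`[c, e]%classic) t)%:E = (e - c)%:E)%E.
  move=> ce; rewrite integral_indic// setIT.
  have /= -> := lebesgue_measure_itv `[c, e]; rewrite lte_fin.
  by case: ltgtP ce => // -> _; rewrite subrr.
have mitv (c e : R) : measurable_fun [set: R] (EFin \o (\1_(`[c, e]%classic) : R -> R)).
  by apply/measurable_EFinP; exact: measurable_indic.
have mdk k : measurable_fun [set: R]
    (fun t => (d k * (\1_(`[a k, b k]%classic) t : R))%:E).
  by apply/measurable_EFinP; apply: measurable_funM => //; exact: measurable_indic.
have indE (c e t : R) : (\1_(`[c, e]%classic) t : R) = (c <= t <= e)%R%:R.
  by rewrite indicE mem_setE in_itv.
rewrite -itvE//.
have -> : (\sum_(k <oo) (d k * (b k - a k))%:E =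
    \sum_(k <oo) \int[@lebesgue_measure R]_t (d k * (\1_(`[a k, b k]%classic) t : R))%:E)%E.
  apply: eq_eseriesr => k _; rewrite EFinM -itvE// -ge0_integralZl_EFin//.
  by apply: measurable_funS (mitv _ _).
rewrite -integral_nneseries//; last first.
  by move=> k t _; rewrite lee_fin mulr_ge0.
apply: ge0_le_integral => //.
- exact: mitv.
- apply: ge0_emeasurable_sum => [k t _ _|k _]; last exact: mdk.
  by rewrite lee_fin mulr_ge0.
- move=> t _; rewrite indE; case: (boolP (l <= t <= h)%R) => [|_]; last first.
    by apply: nneseries_ge0 => k _ _; rewrite lee_fin mulr_ge0.
  move=> lth; apply: le_trans (cov t lth) _.
  by apply: lee_nneseries => k *; rewrite ?indE// lee_fin mulr_ge0.
Qed.

(** Integrating out the last coordinate multiplies each weight by the length of a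
side and leaves the same hypothesis one dimension below. With unit weights this is
a lower bound for the total volume of any cover by boxes. *)
Lemma tri_box_volume_le m g w : (forall i, 0 < w i) ->
  (forall i x y, (forall j, (j < i)%N -> x j = y j) -> g i x = g i y) ->
  forall (c : nat -> R) (A B : nat -> nat -> R),
  (forall k, 0 <= c k) -> (forall k i, A k i <= B k i) ->
  (forall x, tri_box m g w x ->
    (1 <= \sum_(k <oo) (c k * \prod_(i < m) (A k i <= x i <= B k i)%R%:R)%:E)%E) ->
  ((\prod_(i < m) (2 * w i))%:E <=
     \sum_(k <oo) (c k * \prod_(i < m) (B k i - A k i))%:E)%E.
Proof.
move=> w0 gl; elim: m => [|m IH] c A B c0 AB cov.
  rewrite big_ord0; apply: le_trans (cov (fun=> 0) _) _ => //.
  by apply: lee_nneseries => k *; rewrite ?lee_fin !big_ord0 ?mulr1.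
have w2 : 0 < 2 * w m by rewrite mulr_gt0.
pose c' k := c k * (B k m - A k m) / (2 * w m).
have c'0 k : 0 <= c' k by rewrite divr_ge0 ?mulr_ge0 ?subr_ge0// ltW.
have step x : tri_box m g w x ->
    (1 <= \sum_(k <oo) (c' k * \prod_(i < m) (A k i <= x i <= B k i)%R%:R)%:E)%E.
  move=> xT; pose d k := c k * \prod_(i < m) (A k i <= x i <= B k i)%R%:R.
  have p0 k : 0 <= \prod_(i < m) (A k i <= x i <= B k i)%R%:R :> R by rewrite prodr_ge0.
  have d0 k : 0 <= d k by rewrite mulr_ge0.
  have := @integral_indic_series d (A^~ m) (B^~ m) (g m x - w m) (g m x + w m) d0.
  move=> /(_ (fun k => AB k m)); have -> : g m x + w m - (g m x - w m) = 2 * w m by ring.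
  have lh : g m x - w m <= g m x + w m by have := w0 m; lra.
  move=> /(_ lh) H.
  have {H} : ((2 * w m)%:E <= \sum_(k <oo) (d k * (B k m - A k m))%:E)%E.
    apply: H => t tg; apply: le_trans (cov (upd x m t) _) _.
      move=> i; rewrite ltnS leq_eqVlt => /orP[/eqP->|im].
        rewrite updE (gl m _ x); first by rewrite ler_norml; lra.
        by move=> j jm; rewrite upd_lt.
      rewrite upd_lt// (gl i _ x); first exact: xT.
      by move=> j ji; rewrite upd_lt//; exact: ltn_trans im.
    apply: lee_nneseries => k *; first by rewrite lee_fin mulr_ge0// prodr_ge0.
    rewrite lee_fin /d big_ord_recr/= updE mulrA le_eqVlt; apply/orP; left.
    by apply/eqP; congr (_ * _ * _); apply: eq_bigr => i _; rewrite upd_lt.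
  have -> : (\sum_(k <oo) (d k * (B k m - A k m))%:E = (2 * w m)%:E *
      \sum_(k <oo) (c' k * \prod_(i < m) (A k i <= x i <= B k i)%R%:R)%:E)%E.
    rewrite -nneseriesZl; last by move=> k _; rewrite lee_fin mulr_ge0.
    apply: eq_eseriesr => k _; rewrite -EFinM; congr (_%:E).
    by rewrite /d /c'; field; rewrite gt_eqF.
  by rewrite -[leLHS]mule1 lee_pmul2l// lte_fin.
have := IH c' A B c'0 AB step.
rewrite big_ord_recr/= mulrC EFinM => H.
apply: le_trans (lee_wpmul2l _ H) _; first by rewrite lee_fin ltW.
have V0 k : 0 <= \prod_(i < m) (B k i - A k i) by rewrite prodr_ge0// => i _; rewrite subr_ge0.
rewrite -nneseriesZl; last by move=> k _; rewrite lee_fin mulr_ge0.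
apply: lee_nneseries => k *.
  by rewrite -EFinM lee_fin; apply: mulr_ge0; [exact: ltW|exact: mulr_ge0].
rewrite -EFinM lee_fin big_ord_recr/= /c' le_eqVlt; apply/orP; left; apply/eqP.
by field; rewrite gt_eqF.
Qed.

End triangular_boxes.

Section lebesgue_of_triangular_boxes.
Context {R : realType} {n : nat}.
Implicit Types (g : nat -> (nat -> R) -> R) (w : nat -> R) (E : set 'rV[R]_n).

(** Padding with zeros lets the rows be fed to functions of all the coordinates,
where the dimension can vary in inductions. *)
Definition coords (x : 'rV[R]_n) (k : nat) : R := oapp (x 0) 0 (insub k).

Lemma coordsE x (i : 'I_n) : coords x i = x 0 i.
Proof. by rewrite /coords valK. Qed.

(** The cover is completed to an infinite one by points, which are boxes of
volume zero because the dimension is positive. *)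
Lemma lebesgue_rV_finite_cover (I : finType) (A B : I -> 'rV[R]_n) E :
  (0 < n)%N -> (forall k i, A k 0 i <= B k 0 i) ->
  (forall x, E x -> exists k, box (A k) (B k) x) ->
  (lebesgue_rV E <= (\sum_k box_volume (A k) (B k))%:E)%E.
Proof.
move=> n0 AB cov.
pose s := [seq Some k | k <- enum I].
pose a k := oapp A 0 (nth None s k); pose b k := oapp B 0 (nth None s k).
have ab k i : a k 0 i <= b k 0 i by rewrite /a /b; case: (nth None s k) => /=.
apply: ereal_inf_lbound; exists a, b; split.
  split=> // x /cov [k xk]; exists (index k (enum I)) => //.
  have kI : (index k (enum I) < size (enum I))%N by rewrite index_mem mem_enum.
  by rewrite /a /b /s (nth_map k)// nth_index// mem_enum.
have v0 k : (0 <= (box_volume (a k) (b k))%:E)%E.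
  by rewrite lee_fin prodr_ge0// => i _; rewrite subr_ge0.
rewrite (@nneseries_split _ _ 0 (size s))// [X in (_ + X)%E]eseries0 ?adde0; last first.
  move=> k; rewrite add0n => sk _; rewrite /a /b nth_default//= /box_volume.
  by case: n n0 => // m _; rewrite big_ord_recl subrr mul0r.
rewrite add0n sumEFin; congr (_%:E).
pose F (o : option I) := box_volume (oapp A 0 o) (oapp B 0 o).
rewrite -(big_nth None xpredT F) big_map -big_enum.
by apply: eq_bigr.
Qed.

Lemma lebesgue_rV_tri_le g w (L : R) E : (0 < n)%N -> (forall i, 0 < w i) ->
  0 < L -> (forall i x y (d : R), 0 <= d -> (forall j, (j < i)%N -> `|x j - y j| <= d) ->
     `|g i x - g i y| <= L * d) ->
  (forall x, E x -> tri_box n g w (coords x)) ->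
  (lebesgue_rV E <= (\prod_(i < n) (4 * w i))%:E)%E.
Proof.
move=> n0 w0 L0 gL ET.
have [I [A [B [AB cov vol]]]] := tri_box_cover n w0 L0 gL (@ltr01 R).
pose row (f : nat -> R) : 'rV[R]_n := \row_i f i.
apply: le_trans (@lebesgue_rV_finite_cover I (row \o A) (row \o B) E n0 _ _) _.
- by move=> k i; rewrite !mxE; have /andP[] := AB k i (ltn_ord i).
- move=> x /ET/cov [k xk]; exists k => i.
  by rewrite !mxE -coordsE; exact: xk.
- rewrite lee_fin; apply: le_trans vol; apply: ler_sum => k _.
  by rewrite le_eqVlt; apply/orP; left; apply/eqP; apply: eq_bigr => i _; rewrite !mxE.
Qed.

Lemma lebesgue_rV_tri_ge g w E : (forall i, 0 < w i) ->
  (forall i x y, (forall j, (j < i)%N -> x j = y j) -> g i x = g i y) ->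
  (forall x, tri_box n g w x -> E (\row_i x i)) ->
  ((\prod_(i < n) (2 * w i))%:E <= lebesgue_rV E)%E.
Proof.
move=> w0 gl TE; apply/le_ereal_inf_tmp => _ [a [b [[ab cov] ->]]].
have ab' k i : coords (a k) i <= coords (b k) i.
  by rewrite /coords; case: (insub i : option 'I_n) => /=.
apply: le_trans (@tri_box_volume_le _ n g w w0 gl (fun=> 1) (fun k => coords (a k))
  (fun k => coords (b k)) (fun=> ler01) ab' _) _.
  move=> x xT; have [k _ xk] := cov _ (TE x xT).
  pose f j : \bar R := (1 * \prod_(i < n) (coords (a j) i <= x i <= coords (b j) i)%R%:R)%:E.
  have f0 j : (0 <= f j)%E by rewrite lee_fin mul1r prodr_ge0.
  apply: le_trans (nneseries_lim_ge k.+1 (fun j _ _ => f0 j)).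
  rewrite big_nat_recr//= -[leLHS]add0e; apply: leeD; first exact: sume_ge0.
  rewrite lee_fin mul1r big1// => i _.
  by have := xk i; rewrite mxE !coordsE => ->.
apply: lee_nneseries => k *.
  by rewrite lee_fin mul1r prodr_ge0// => i _; rewrite subr_ge0.
rewrite lee_fin mul1r le_eqVlt; apply/orP; left; apply/eqP.
by apply: eq_bigr => i _; rewrite !coordsE.
Qed.

End lebesgue_of_triangular_boxes.

(** * Normal form of convex bodies *)

Section normal_form.
Context {R : realType} {n : nat}.
Implicit Types (K : set 'rV[R]_n) (x y z v : 'rV[R]_n).

Definition segment_closed K : Prop :=
  forall x y (s : R), K x -> K y -> 0 <= s <= 1 -> K (x + s *: (y - x)).

Definition normalised K (E : 'M[R]_n) y0 : Prop :=
  forall z, K z -> forall k, `|((z - y0) *m E) 0 k| <= 1.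

Lemma average_in K (m : nat) (p : nat -> 'rV[R]_n) : segment_closed K ->
  (forall j, (j <= m)%N -> K (p j)) -> K (m.+1%:R^-1 *: \sum_(j < m.+1) p j).
Proof.
move=> cK; elim: m => [|m IH] Kp.
  by rewrite big_ord1 invr1 scale1r; exact: Kp.
have Km : K (m.+1%:R^-1 *: \sum_(j < m.+1) p j).
  by apply: IH => j jm; apply: Kp; exact: leqW.
have m0 : m.+1%:R != 0 :> R by rewrite pnatr_eq0.
have m1 : m.+2%:R != 0 :> R by rewrite pnatr_eq0.
have := cK _ (p m.+1) m.+2%:R^-1 Km (Kp _ (leqnn _)).
rewrite invr_ge0 ler0n invf_le1 ?ltr0n// ler1n => /(_ isT).
suff -> : m.+1%:R^-1 *: \sum_(j < m.+1) p j +
    m.+2%:R^-1 *: (p m.+1 - m.+1%:R^-1 *: \sum_(j < m.+1) p j) =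
    m.+2%:R^-1 *: \sum_(j < m.+2) p j by [].
rewrite [in RHS]big_ord_recr/= !scalerDr addrCA addrC; congr (_ + _).
rewrite -scaleNr scalerA -scalerDl; congr (_ *: _).
move: m0 m1; rewrite -[m.+2%:R]natr1; move: (m.+1%:R : R) => a a0 a1.
by field; rewrite a1 a0.
Qed.

Context (K : set 'rV[R]_n) (cptK : compact K) (cvxK : segment_closed K).
Context (p0 : 'rV[R]_n) (d0 : R) (d0_gt0 : 0 < d0).
Context (intK : forall y, (forall i, `|y 0 i - p0 0 i| < d0) -> K y).

Let Kp0 : K p0.
Proof. by apply: intK => i; rewrite subrr normr0. Qed.

(* Interior points make every normalised coordinate nonconstant on [K]. *)
Let coord_nonconstant (f : 'rV[R]_n) (k : 'I_n) (a : R) : f 0 k = 1 ->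
  ~ (forall z, K z -> dotv f z = a).
Proof.
move=> fk fa; have d20 : 0 < d0 / 2 by rewrite divr_gt0.
have Kp1 : K (p0 + (d0 / 2) *: delta_mx 0 k).
  apply: intK => i; rewrite !mxE addrAC subrr add0r eqxx/= normrM normr_nat.
  by rewrite gtr0_norm//; case: eqP => _; rewrite ?mulr1 ?mulr0//; lra.
by have := fa _ Kp1; rewrite dotvDr dotvZr dotv_delta fk mulr1 fa//; lra.
Qed.

(** The normalising coordinates are built greedily: [F k] is the [k]-th
coordinate corrected by earlier ones so as to vanish at the earlier points
[Y j], and [Y k] is where it is largest on [K]. *)
Let greedy (m : nat) : (m <= n)%N -> exists F Y : nat -> 'rV[R]_n,
  forall k : 'I_n, (k < m)%N ->
    [/\ F k 0 k = 1, forall i : 'I_n, (k < i)%N -> F k 0 i = 0,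
        K (Y k),
        forall z, K z -> `|dotv (F k) (z - p0)| <= `|dotv (F k) (Y k - p0)| &
        forall j, (j < k)%N -> dotv (F k) (Y j - p0) = 0].
Proof.
elim: m => [|m IH] mn; first by exists (fun=> 0), (fun=> 0).
have [F [Y FY]] := IH (ltnW mn); pose k := Ordinal mn.
have nz (j : nat) : (j < m)%N -> dotv (F j) (Y j - p0) != 0.
  move=> jm; pose l := Ordinal (ltn_trans jm mn).
  have [Fl _ _ Fmax _] := FY l jm; apply/eqP => E.
  apply: (@coord_nonconstant (F j) l (dotv (F j) p0) Fl) => z /Fmax.
  by rewrite /= E normr0 normr_le0 dotvBr subr_eq0 => /eqP.
have [f [fk fgt f0]] : exists f : 'rV[R]_n, [/\ f 0 k = 1,
    forall i : 'I_n, (k < i)%N -> f 0 i = 0 &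
    forall j, (j < m)%N -> dotv f (Y j - p0) = 0].
  suff : forall l, (l <= m)%N -> exists f : 'rV[R]_n, [/\ f 0 k = 1,
    forall i : 'I_n, (k < i)%N -> f 0 i = 0 &
    forall j, (j < l)%N -> dotv f (Y j - p0) = 0] by move/(_ m (leqnn m)).
  elim=> [|l IHl] lm.
    exists (delta_mx 0 k); split=> [|i ki|//]; rewrite mxE ?eqxx//.
    by rewrite -(inj_eq val_inj) (gtn_eqF ki) andbF.
  have [f [fk fgt f0]] := IHl (ltnW lm).
  pose l' := Ordinal (ltn_trans lm mn).
  have [Fl Flgt _ _ Fl0] := FY l' lm.
  exists (f - (dotv f (Y l - p0) / dotv (F l) (Y l - p0)) *: F l); split.
  - by rewrite !mxE fk (Flgt k lm) mulr0 subr0.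
  - by move=> i ki; rewrite !mxE fgt// (Flgt i (ltn_trans lm ki)) mulr0 subr0.
  - move=> j; rewrite ltnS leq_eqVlt => /orP[/eqP->|jl].
      by rewrite dotvBl dotvZl divfK ?subrr// nz.
    by rewrite dotvBl dotvZl f0// (Fl0 j jl) mulr0 subr0.
have [y yK ymax] : exists2 y, K y &
    forall z, K z -> `|dotv f (z - p0)| <= `|dotv f (y - p0)|.
  have [||y /set_mem yK ymax] := @EVT_max_rV _ _ (fun z => `|dotv f (z - p0)|) K _ cptK.
  - by exists p0.
  - apply: continuous_subspaceT => z.
    apply: (@continuous_comp _ _ _ (fun z => dotv f (z - p0)) (fun r : R => `|r|));
      last exact: norm_continuous.
    rewrite (_ : (fun z => _) = (fun z => dotv f z - dotv f p0)); last first.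
      by apply/funext => u; rewrite dotvBr.
    by apply: continuousB; [exact: continuous_dotv|exact: cst_continuous].
  - by exists y => // z /mem_set/ymax.
exists (fun j => if j == m then f else F j), (fun j => if j == m then y else Y j).
move=> j; rewrite ltnS leq_eqVlt => /orP[/eqP jm|jm].
  have -> : j = k by apply: val_inj.
  rewrite /= eqxx; split=> // i im; rewrite ltn_eqF//; exact: f0.
rewrite ltn_eqF//; have [? ? ? ? Fj0] := FY j jm; split=> // i ij.
by rewrite ltn_eqF ?(ltn_trans ij)//; exact: Fj0.
Qed.

(** Half of the barycentric weight [1 / n], divided by the loss [n.+1 ^ n] of back
substitution. *)
Definition inner_radius (m : nat) : R := (2 * m%:R * m.+1%:R ^+ m)^-1.

Lemma inner_radius_gt0 m : (0 < m)%N -> 0 < inner_radius m.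
Proof. by move=> m0; rewrite invr_gt0 !mulr_gt0 ?exprn_gt0 ?ltr0n. Qed.

(** Back substitution in a unipotent triangular system with coefficients
bounded by one. *)
Let unipotent_bound (G : 'M[R]_n) (t : 'rV[R]_n) (e : R) : 0 <= e ->
  (forall j k, `|G j k| <= 1) -> (forall k, G k k = 1) ->
  (forall j k : 'I_n, (j < k)%N -> G j k = 0) ->
  (forall k, `|(t *m G) 0 k| <= e) ->
  forall k, `|t 0 k| <= n.+1%:R ^+ n * e.
Proof.
move=> e0 G1 Gd Gl tG.
suff H m (k : 'I_n) : (n <= k + m)%N -> `|t 0 k| <= n.+1%:R ^+ m * e.
  by move=> k; apply: H; rewrite leq_addl.
elim: m k => [|m IH] k; first by rewrite addn0 leqNgt ltn_ord.
move=> nkm; have := tG k; rewrite mxE (bigD1 k)//= Gd mulr1.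
set S := \sum_(j | _) _ => tS.
have Sle : `|S| <= n%:R * (n.+1%:R ^+ m * e).
  apply: le_trans (ler_norm_sum _ _ _) _.
  apply: (@le_trans _ _ (\sum_(j < n) n.+1%:R ^+ m * e)); last first.
    by rewrite sumr_const card_ord mulr_natl.
  rewrite big_mkcond; apply: ler_sum => j _.
  have nn : 0 <= n.+1%:R ^+ m * e by rewrite mulr_ge0// exprn_ge0.
  case: eqVneq => [//|jk] /=; have [jlt|jgt] := ltnP j k.
    by rewrite Gl// mulr0 normr0.
  rewrite normrM -[leRHS]mulr1; apply: ler_pM => //; apply: IH.
  have kj : (k < j)%N by rewrite ltn_neqAle jgt andbT; apply: contra jk => /eqP/val_inj->.
  by apply: leq_trans nkm _; rewrite addnS -addSn leq_add2r.
have -> : t 0 k = (t 0 k + S) - S by rewrite addrK.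
apply: le_trans (ler_normB _ _) _.
have -> : n.+1%:R ^+ m.+1 * e = n.+1%:R ^+ m * e + n%:R * (n.+1%:R ^+ m * e).
  by rewrite exprS; move: (n.+1%:R ^+ m) => P; rewrite -natr1; ring.
apply: lerD => //; apply: le_trans tS _; rewrite ler_peMl// exprn_ege1//.
by rewrite ler1n.
Qed.

(* The triangular map of which [|dotv (F k) (x - c)| <= w k] is the box. *)
Let affine_tri (F : nat -> 'rV[R]_n) (c : 'rV[R]_n) (i : nat) (x : nat -> R) : R :=
  if (insub i : option 'I_n) is Some k then
    dotv (F k) c - \sum_(j < n | (j < k)%N) F k 0 j * x j
  else 0.

Let affine_triE (F : nat -> 'rV[R]_n) c (k : 'I_n) (x : nat -> R) :
  F k 0 k = 1 -> (forall i : 'I_n, (k < i)%N -> F k 0 i = 0) ->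
  x k - affine_tri F c k x = dotv (F k) (\row_i x i - c).
Proof.
move=> Fk Fgt; rewrite /affine_tri valK dotvBr opprB addrA; congr (_ - _).
rewrite [RHS](bigD1 k)//= Fk mul1r mxE; congr (_ + _).
rewrite big_mkcond [RHS]big_mkcond; apply: eq_bigr => j _.
have [->|jk] := eqVneq j k; first by rewrite ltnn.
rewrite /= mxE; have [//|kj] := ltnP j k.
by rewrite Fgt ?mul0r// ltn_neqAle kj andbT eq_sym.
Qed.

Let affine_tri_lipschitz (F : nat -> 'rV[R]_n) c i (x y : nat -> R) (d : R) :
  0 <= d -> (forall j, (j < i)%N -> `|x j - y j| <= d) ->
  `|affine_tri F c i x - affine_tri F c i y| <=
    (1 + \sum_(k < n) \sum_(j < n) `|F k 0 j|) * d.
Proof.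
have S0 (k : nat) : 0 <= \sum_(j < n) `|F k 0 j| by exact: sumr_ge0.
move=> dge0 xy; rewrite /affine_tri; case: insubP => [k _ ki|_]; last first.
  by rewrite subrr normr0 mulr_ge0 ?addr_ge0 ?sumr_ge0.
rewrite opprB addrC addrA subrK -sumrB.
apply: (@le_trans _ _ (\sum_(j < n) `|F k 0 j| * d)).
  apply: le_trans (ler_norm_sum _ _ _) _; rewrite big_mkcond.
  apply: ler_sum => j _; case: ifPn => jk; last by rewrite mulr_ge0.
  by rewrite -mulrBr normrM ler_wpM2l// distrC xy// -ki.
rewrite -mulr_suml ler_wpM2r//; apply: ler_wpDl => //.
by rewrite [leRHS](bigD1 k)//= lerDl sumr_ge0.
Qed.

(** With [d k] the largest value on [K] of the [k]-th greedy coordinate, [K] lies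
in the triangular box of half-widths [d k] around [p0]; it contains the simplex
spanned by [p0] and the points [Y k], whose matrix in these coordinates is
unipotent with entries at most one, and back substitution yields a triangular box
of half-widths [inner_radius n * d k] in the simplex. Here [D] is the product of
the [d k]. *)
Lemma normal_form : (0 < n)%N -> exists (E : 'M[R]_n) (y0 c : 'rV[R]_n) (D : R),
  [/\ 0 < D,
      normalised K E y0,
      forall z, (forall k, `|((z - c) *m E) 0 k| <= inner_radius n) -> K z,
      \det (E *m E^T) = D ^- 2 &
      (((2 * inner_radius n) ^+ n * D)%:E <= lebesgue_rV K <= (4 ^+ n * D)%:E)%E].
Proof.
move=> n0; have [F [Y FY]] := greedy (leqnn n).
pose q (k : nat) := dotv (F k) (Y k - p0).
have q_neq0 (k : 'I_n) : q k != 0.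
  have [Fk _ _ Fmax _] := FY k (ltn_ord k); apply/eqP => qk0.
  apply: (@coord_nonconstant (F k) k (dotv (F k) p0) Fk) => z /Fmax.
  by rewrite -/(q k) qk0 normr0 normr_le0 dotvBr subr_eq0 => /eqP.
pose E : 'M[R]_n := \matrix_(i, k) ((q k)^-1 * F k 0 i).
pose YM : 'M[R]_n := \matrix_(j, i) (Y j - p0) 0 i.
pose D := \prod_(k < n) `|q k|.
have D0 : 0 < D by apply: prodr_gt0 => k _; rewrite normr_gt0.
have mulE v (k : 'I_n) : (v *m E) 0 k = (q k)^-1 * dotv (F k) v.
  rewrite mxE /dotv mulr_sumr; apply: eq_bigr => i _.
  by rewrite mxE mulrCA (mulrC (v 0 i)).
have detE : \det E = \prod_(k < n) (q k)^-1.
  rewrite -det_tr det_trig; last first.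
    apply/is_trig_mxP => i j ij; rewrite !mxE.
    by have [_ -> // _ _ _] := FY i (ltn_ord i); rewrite mulr0.
  apply: eq_bigr => k _; rewrite !mxE.
  by have [-> _ _ _ _] := FY k (ltn_ord k); rewrite mulr1.
pose G := YM *m E.
have GE (j k : 'I_n) : G j k = (q k)^-1 * dotv (F k) (Y j - p0).
  rewrite -mulE /G !mxE; apply: eq_bigr => i _.
  by rewrite [YM _ _]mxE !mxE.
have Gl (j k : 'I_n) : (j < k)%N -> G j k = 0.
  by move=> jk; have [_ _ _ _ F0] := FY k (ltn_ord k); rewrite GE F0// mulr0.
have Gd k : G k k = 1 by rewrite GE mulVf.
have G1 (j k : 'I_n) : `|G j k| <= 1.
  have [_ _ _ Fmax _] := FY k (ltn_ord k); have [_ _ YK _ _] := FY j (ltn_ord j).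
  rewrite GE normrM normfV ler_pdivrMl ?normr_gt0// mulr1; exact: Fmax.
have YMu : YM \in unitmx.
  have : \det G = 1.
    rewrite det_trig ?big1//; apply/is_trig_mxP => i j; exact: Gl.
  rewrite /G det_mulmx unitmxE unitfE => dG; apply/eqP => dY.
  by move: dG; rewrite dY mul0r => /eqP; rewrite eq_sym oner_eq0.
have n1 : 0 < n%:R :> R by rewrite ltr0n.
pose h : R := (2 * n%:R)^-1.
have h0 : 0 < h by rewrite invr_gt0 mulr_gt0.
pose c := p0 + (const_mx h *m YM).
exists E, p0, c, D.
have inner z : (forall k, `|((z - c) *m E) 0 k| <= inner_radius n) -> K z.
  move=> zc; pose mu := (z - p0) *m invmx YM.
  have muE : mu *m YM = z - p0 by rewrite mulmxKV.
  pose t := mu - const_mx h.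
  have tG : t *m G = (z - c) *m E.
    by rewrite /G mulmxA mulmxBl muE /c opprD addrA.
  have tle (k : 'I_n) : `|t 0 k| <= h.
    have -> : h = n.+1%:R ^+ n * inner_radius n.
      by rewrite /h /inner_radius [in RHS]invfM mulrCA mulfV ?mulr1// expf_neq0// pnatr_eq0.
    apply: (@unipotent_bound G) => // [|k']; last by rewrite tG.
    exact/ltW/inner_radius_gt0.
  have mu01 k : 0 <= n%:R * mu 0 k <= 1.
    have := tle k; have -> : t 0 k = mu 0 k - h.
      by rewrite [LHS]mxE [X in _ + X]mxE [X in - X]mxE.
    move=> /ler_normlP; move: (mu 0 k) => m [].
    have hn : n%:R * h = 2^-1 :> R by rewrite /h invfM mulrCA mulfV ?mulr1// gt_eqF.
    clearbody h; move=> H1 H2; apply/andP; split.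
      by rewrite mulr_ge0//; lra.
    have : n%:R * m <= n%:R * (2 * h) by rewrite ler_wpM2l//; lra.
    by rewrite mulrCA hn; lra.
  pose p (j : nat) : 'rV[R]_n :=
    p0 + (n%:R * coords mu j) *: (Y j - p0).
  (* The simplex point with weights [mu] is an average of [n] points of segments. *)
  have -> : z = n.-1.+1%:R^-1 *: \sum_(j < n.-1.+1) p j.
    rewrite prednK// big_split/= sumr_const card_ord scalerDr.
    rewrite -[p0 *+ n]scaler_nat scalerA mulVf ?gt_eqF// scale1r -[LHS](subrK p0) addrC.
    congr (_ + _); rewrite -muE scaler_sumr; apply/rowP => i.
    rewrite mxE summxE; apply: eq_bigr => j _.
    by rewrite coordsE scalerA mulrA mulVf ?gt_eqF// mul1r !mxE.
  apply: average_in => // j; rewrite -ltnS prednK// => jn.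
  have [_ _ YK _ _] := FY (Ordinal jn) jn.
  apply: cvxK => //; rewrite (coordsE mu (Ordinal jn)); exact: mu01.
have Eq z k : K z -> `|((z - p0) *m E) 0 k| <= 1.
  have [_ _ _ Fmax _] := FY k (ltn_ord k) => /Fmax.
  by rewrite mulE normrM normfV ler_pdivrMl ?normr_gt0// mulr1.
split=> //; first by move=> z Kz k; exact: Eq.
- rewrite det_mulmx det_tr detE -expr2 prodfV exprVn; congr (_^-1).
  by rewrite /D -normr_prod real_normK// num_real.
- pose w (i : nat) := if (i < n)%N then `|q i| else 1.
  have w0 i : 0 < w i.
    by rewrite /w; case: ifP => // i_n; rewrite normr_gt0 (q_neq0 (Ordinal i_n)).
  have wE (k : 'I_n) : w k = `|q k| by rewrite /w ltn_ord.
  have r0 := inner_radius_gt0 n0.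
  have Dw (a : R) : a ^+ n * D = \prod_(k < n) (a * w k).
    rewrite big_split/= prodr_const card_ord; congr (_ * _).
    by apply: eq_bigr => k _; rewrite wE.
  rewrite !Dw; apply/andP; split.
  + under eq_bigr do rewrite -mulrA.
    apply: (@lebesgue_rV_tri_ge _ _ (affine_tri F c) (fun i => inner_radius n * w i)).
    * by move=> i; rewrite mulr_gt0.
    * move=> i x y xy; rewrite /affine_tri; case: insubP => // k _ ki.
      by congr (_ - _); apply: eq_bigr => j jk; rewrite xy// -ki.
    * move=> x xT; apply: inner => k; have [Fk Fgt _ _ _] := FY k (ltn_ord k).
      rewrite mulE -(affine_triE _ _ Fk Fgt) normrM normfV.
      rewrite ler_pdivrMl ?normr_gt0// mulrC -wE; exact: xT.
  + apply: (@lebesgue_rV_tri_le _ _ (affine_tri F p0) w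
      (1 + \sum_(k < n) \sum_(j < n) `|F k 0 j|)) => //.
    * by rewrite ltr_pwDl// sumr_ge0// => k _; exact: sumr_ge0.
    * move=> i x y d; exact: affine_tri_lipschitz.
    * move=> x Kx i i_n; pose k := Ordinal i_n.
      have [Fk Fgt _ Fmax _] := FY k i_n.
      have -> : coords x i - affine_tri F p0 i (coords x) = dotv (F i) (x - p0).
        have xE : \row_j coords x j = x by apply/rowP => j; rewrite mxE coordsE.
        by have := affine_triE p0 (coords x) Fk Fgt; rewrite xE.
      by rewrite /w i_n; exact: Fmax.
Qed.

End normal_form.

(** * Continuity on a set and convex domains *)

Section continuity_on_a_set.
Context {R : realType} {n : nat}.
Implicit Types (A : set 'rV[R]_n) (f g : 'rV[R]_n -> R).

Lemma within_continuous_cubeP A f : {within A, continuous f} <->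
  forall x, A x -> forall e : R, 0 < e -> exists2 d : R, 0 < d &
    forall y, A y -> (forall i, `|y 0 i - x 0 i| < d) -> `|f y - f x| < e.
Proof.
split=> [/subspace_continuousP fA x Ax e e0|fA].
  have [d d0 dP] : exists2 d : R, 0 < d & forall y : 'rV[R]_n,
      (forall i, `|y 0 i - x 0 i| < d) -> A y -> `|f y - f x| < e.
    apply/nbhs_cubeP; have : nbhs (f x) [set r | `|r - f x| < e].
      by apply/nbhs_ballP; exists e => //= r; rewrite -ball_normE/= distrC.
    exact: (fA x Ax).
  by exists d => // y Ay yx; exact: dP.
apply/subspace_continuousP => x Ax B /nbhs_ballP[e /= e0 eB].
have [d d0 dP] := fA x Ax e e0.
apply/nbhs_cubeP; exists d => // y yx Ay; apply: eB.
by rewrite -ball_normE/= distrC; exact: dP.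
Qed.

Lemma within_continuousD A f g : {within A, continuous f} ->
  {within A, continuous g} -> {within A, continuous (fun x => f x + g x)}.
Proof. by move=> fA gA x; apply: continuousD; [exact: fA|exact: gA]. Qed.

Lemma within_continuousM A f g : {within A, continuous f} ->
  {within A, continuous g} -> {within A, continuous (fun x => f x * g x)}.
Proof. by move=> fA gA x; apply: continuousM; [exact: fA|exact: gA]. Qed.

Lemma within_continuous_cst A (a : R) : {within A, continuous (fun=> a)}.
Proof. by move=> x; exact: cst_continuous. Qed.

Lemma within_continuousB A f g : {within A, continuous f} ->
  {within A, continuous g} -> {within A, continuous (fun x => f x - g x)}.
Proof.
move=> fA gA; apply: within_continuousD => //.
rewrite (_ : (fun x => _) = (fun x => (-1) * g x)).
  by apply: within_continuousM => //; exact: within_continuous_cst.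
by apply/funext => x; rewrite mulN1r.
Qed.

Lemma within_continuous_coord A i : {within A, continuous (fun x : 'rV[R]_n => x 0 i)}.
Proof. by apply: continuous_subspaceT; exact: coord_continuous. Qed.

Lemma within_continuous_sum (I : finType) A (F : I -> 'rV[R]_n -> R) :
  (forall i, {within A, continuous (F i)}) ->
  {within A, continuous (fun x => \sum_i F i x)}.
Proof.
move=> FA; suff H (s : seq I) : {within A, continuous (fun x => \sum_(i <- s) F i x)}.
  exact: H.
elim: s => [|i s IH].
  rewrite (_ : (fun x => _) = fun=> 0); first exact: within_continuous_cst.
  by apply/funext => x; rewrite big_nil.
rewrite (_ : (fun x => _) = fun x => F i x + \sum_(j <- s) F j x).
  exact: within_continuousD.
by apply/funext => x; rewrite big_cons.
Qed.

Lemma within_continuous_dotv A (P Q : 'rV[R]_n -> 'rV[R]_n) :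
  (forall i, {within A, continuous (fun x => P x 0 i)}) ->
  (forall i, {within A, continuous (fun x => Q x 0 i)}) ->
  {within A, continuous (fun x => dotv (P x) (Q x))}.
Proof.
by move=> PA QA; apply: within_continuous_sum => i; apply: within_continuousM.
Qed.

Lemma within_continuous_qform A (M : 'M[R]_n) (c : 'rV[R]_n) :
  {within A, continuous (fun x => qform M (x - c))}.
Proof.
have cA i : {within A, continuous (fun x : 'rV[R]_n => (x - c) 0 i)}.
  rewrite (_ : (fun x => _) = fun x : 'rV[R]_n => x 0 i - c 0 i).
    apply: within_continuousB; first exact: within_continuous_coord.
    exact: within_continuous_cst.
  by apply/funext => x; rewrite !mxE.
apply: within_continuous_sum => i; apply: within_continuous_sum => j.
apply: within_continuousM => //; apply: within_continuousM => //.
exact: within_continuous_cst.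
Qed.

Lemma continuous_ge0_closure (U : set 'rV[R]_n) f :
  {within closure U, continuous f} -> (forall x, U x -> 0 <= f x) ->
  forall x, closure U x -> 0 <= f x.
Proof.
move=> /within_continuous_cubeP fU f0 x Ux; rewrite leNgt; apply/negP => fx.
have [|d d0 dP] := fU x Ux (- f x); first by rewrite oppr_gt0.
have [y Uy yx] := (closure_cubeP U x).1 Ux d d0.
have := dP y (subset_closure Uy) yx; have := f0 y Uy.
by rewrite ltr_norml => *; lra.
Qed.

Lemma continuous_le_closed A f (a : R) : closed A ->
  {within A, continuous f} -> closed [set x | A x /\ f x <= a].
Proof.
move=> clA /within_continuous_cubeP fA x xcl.
have Ax : A x by apply: clA; apply: closureS xcl => y [].
split=> //; rewrite leNgt; apply/negP => fx.
have [|d d0 dP] := fA x Ax (f x - a); first by rewrite subr_gt0.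
have [y [Ay fy] yx] := (closure_cubeP _ x).1 xcl d d0.
by have := dP y Ay yx; rewrite ltr_norml => *; lra.
Qed.

End continuity_on_a_set.

Section convex_domains.
Context {R : realType} {n : nat} (Omega : set 'rV[R]_n).
Context (dom : convex_domain Omega).
Implicit Types (x y z v w : 'rV[R]_n).

Let oO : open Omega. Proof. by case: dom. Qed.

Lemma domain_segment : segment_closed Omega.
Proof.
case: dom => _ _ cO x y s Ox Oy /andP[s0 s1].
have := cO y x (Itv01 s0 s1) (mem_set Oy) (mem_set Ox) => /set_mem.
suff -> : x + s *: (y - x) = s *: y + (1 - s) *: x by [].
by rewrite scalerBl scale1r scalerBr addrCA.
Qed.

Lemma segment_closed_closure (U : set 'rV[R]_n) :
  segment_closed U -> segment_closed (closure U).
Proof.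
move=> cU x y s xU yU s01; apply/closure_cubeP => d d0.
have [x' Ux' xx] := (closure_cubeP _ _).1 xU d d0.
have [y' Uy' yy] := (closure_cubeP _ _).1 yU d d0.
exists (x' + s *: (y' - x')); first exact: cU.
case/andP: s01 => s0 s1 i; rewrite !mxE.
have -> : x' 0 i + s * (y' 0 i - x' 0 i) - (x 0 i + s * (y 0 i - x 0 i)) =
  (1 - s) * (x' 0 i - x 0 i) + s * (y' 0 i - y 0 i) by ring.
have := xx i; have := yy i; rewrite !ltr_norml => /andP[a1 a2] /andP[b1 b2].
have [->|sn1] := eqVneq s 1; first by rewrite subrr mul0r add0r mul1r a1.
have s'0 : 0 < 1 - s by rewrite subr_gt0 lt_neqAle sn1.
by apply/andP; split; nra.
Qed.

Lemma closure_segment : segment_closed (closure Omega).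
Proof. exact/segment_closed_closure/domain_segment. Qed.

Lemma bdryE z : bdry Omega z <-> closure Omega z /\ ~ Omega z.
Proof.
rewrite /bdry /setD/=; split=> -[cz oz]; split=> // zO; apply: oz.
  by move: oO; rewrite openE; apply.
exact: interior_subset.
Qed.

Lemma in_or_bdry z : closure Omega z -> Omega z \/ bdry Omega z.
Proof.
move=> cz; have [Oz|nOz] := pselect (Omega z); [by left|right].
exact/bdryE.
Qed.

(** Replace [x] by a nearby point of the domain and adjust the other end so that the
point in between stays the same; there is room around [y] for that. *)
Lemma open_segment_in x y (s : R) : closure Omega x -> Omega y ->
  0 < s <= 1 -> Omega (x + s *: (y - x)).
Proof.
move=> xO yO /andP[s0 s1]; have [d d0 dO] := open_cube oO yO.
have [->|sn1] := eqVneq s 1; first by rewrite scale1r addrC subrK.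
have t0 : 0 < 1 - s by rewrite subr_gt0 lt_neqAle sn1.
have [x' x'O xx] := (closure_cubeP _ _).1 xO (d * s) (mulr_gt0 d0 s0).
pose y' := y + ((1 - s) / s) *: (x - x').
have -> : x + s *: (y - x) = x' + s *: (y' - x').
  by apply/rowP => i; rewrite !mxE; field; rewrite gt_eqF.
apply: domain_segment => //; last by rewrite ltW.
apply: dO => i; rewrite !mxE addrAC subrr add0r normrM distrC.
rewrite gtr0_norm ?divr_gt0//.
have : (1 - s) / s * `|x' 0 i - x 0 i| < (1 - s) / s * (d * s).
  by rewrite ltr_pM2l ?divr_gt0.
move=> /lt_le_trans; apply.
have -> : (1 - s) / s * (d * s) = (1 - s) * d by field; rewrite gt_eqF.
by rewrite ler_piMl//; lra.
Qed.

(** Take the supremum of the parameters for which the segment is in the domain. *)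
Lemma segment_meets_bdry x y : Omega x -> ~ Omega y ->
  exists2 s : R, 0 <= s <= 1 & bdry Omega (x + s *: (y - x)).
Proof.
move=> Ox Oy; pose S := [set s : R | 0 <= s <= 1 /\ Omega (x + s *: (y - x))].
have S0 : S 0 by rewrite /S/= lexx ler01 scale0r addr0.
have Sb : has_ubound S by exists 1 => s [/andP[]].
have S_sup : has_sup S by split=> //; exists 0.
pose s := sup S.
have s0 : 0 <= s by apply: ub_le_sup.
have s1 : s <= 1 by apply: ge_sup; [exists 0|move=> t [/andP[]]].
exists s; first by rewrite s0.
set z := x + s *: (y - x).
have zE (t : R) : x + t *: (y - x) = z + (t - s) *: (y - x).
  by apply/rowP => i; rewrite /z !mxE; ring.
apply/bdryE; split.
  apply/closure_cubeP => d d0; have [e e0 eP] := line_in_cube z (y - x) d0.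
  have [t [t01 tO] ts] := sup_adherent e0 S_sup.
  exists (x + t *: (y - x)) => //; rewrite zE; apply: eP.
  have : t <= s by apply: ub_le_sup.
  by rewrite -/s in ts; move=> tles; rewrite ler0_norm; lra.
move=> Oz; have [d d0 dO] := open_cube oO Oz.
have sn1 : s < 1.
  rewrite lt_neqAle s1 andbT; apply/eqP => se; apply: Oy.
  by move: Oz; rewrite /z se scale1r addrC subrK.
have [e e0 eP] := line_in_cube z (y - x) d0.
have s'0 : 0 < 1 - s by rewrite subr_gt0.
have [m [m0 me ms]] := exists_below e0 s'0.
have : S (s + m).
  split; first by apply/andP; split; lra.
  by apply: dO; rewrite zE; apply: eP; rewrite addrAC subrr add0r gtr0_norm.
by move=> /(ub_le_sup Sb); rewrite -/s; lra.
Qed.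

End convex_domains.

(** * The gap function, comparison and the upper bound *)

Section quadratic_touching.
Context {R : realType} {n : nat}.
Implicit Types (x y z v w b : 'rV[R]_n) (M : 'M[R]_n).

Lemma qform0 M : qform M 0 = 0.
Proof. by rewrite qformE mul0mx mul0mx mxE. Qed.

Lemma qform_line M p v (s : R) : qform M (p + s *: v) =
  qform M p + (qform M (p + v) - qform M p - qform M v) * s + qform M v * s ^+ 2.
Proof.
have addE (A B : 'M[R]_1) : (A + B) 0 0 = A 0 0 + B 0 0 by rewrite mxE.
have sclE (k : R) (A : 'M[R]_1) : (k *: A) 0 0 = k * A 0 0 by rewrite mxE.
have E (t : R) : qform M (p + t *: v) = qform M p +
    t * ((p *m M *m v^T) 0 0 + (v *m M *m p^T) 0 0) + t ^+ 2 * qform M v.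
  rewrite !qformE linearD linearZ/= mulmxDl mulmxDl !mulmxDr -!scalemxAl -!scalemxAr.
  by rewrite !(addE, sclE); ring.
by have := E 1; rewrite scale1r !E => ->; ring.
Qed.

Definition quadratic (k : R) b M x y : R := k + dotv b (y - x) + qform M (y - x).

Lemma quadratic_line k b M x z v : exists a : R, forall s : R,
  quadratic k b M x (z + s *: v) = quadratic k b M x z + a * s + qform M v * s ^+ 2.
Proof.
exists (dotv b v + (qform M (z - x + v) - qform M (z - x) - qform M v)) => s.
by rewrite /quadratic (addrAC z (s *: v)) qform_line (dotvDr (z - x) (s *: v)) dotvZr; ring.
Qed.

Lemma within_continuous_quadratic A k b M x :
  {within A, continuous (quadratic k b M x)}.
Proof.
apply: within_continuousD; last exact: within_continuous_qform.
apply: within_continuousD; first exact: within_continuous_cst.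
rewrite (_ : (fun y => _) = fun y => dotv b y - dotv b x); last first.
  by apply/funext => y; rewrite dotvBr.
apply: within_continuousB; last exact: within_continuous_cst.
by apply: continuous_subspaceT; exact: continuous_dotv.
Qed.

(** [l] stands for a tangent plane: being affine on lines, it does not affect
second derivatives. *)
Lemma touching_below (U : set 'rV[R]_n) (f l : 'rV[R]_n -> R) k b M x z (d : R) :
  open U -> C2_on U f -> U z -> 0 < d ->
  (forall v, exists a : R, forall s : R, l (z + s *: v) = l z + a * s) ->
  (forall y, (forall i, `|y 0 i - z 0 i| < d) ->
     f z - l z - quadratic k b M x z <= f y - l y - quadratic k b M x y) ->
  forall v, 2 * qform M v <= qform (hessian f z) v.
Proof.
move=> oU fC2 Uz d0 laff fmin v; have [e e0 eP] := line_in_cube z v d0.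
have [a aE] := laff v; have [a' a'E] := quadratic_line k b M x z v.
apply: (@hessian_ge _ _ U f z v e (a + a') _ oU fC2 Uz e0) => s /eP/fmin.
by rewrite aE a'E; lra.
Qed.

Lemma touching_above (U : set 'rV[R]_n) (f l : 'rV[R]_n -> R) k b M x z (d : R) :
  open U -> C2_on U f -> U z -> 0 < d ->
  (forall v, exists a : R, forall s : R, l (z + s *: v) = l z + a * s) ->
  (forall y, (forall i, `|y 0 i - z 0 i| < d) ->
     f y - l y - quadratic k b M x y <= f z - l z - quadratic k b M x z) ->
  forall v, qform (hessian f z) v <= 2 * qform M v.
Proof.
move=> oU fC2 Uz d0 laff fmax v; have [e e0 eP] := line_in_cube z v d0.
have [a aE] := laff v; have [a' a'E] := quadratic_line k b M x z v.
apply: (@hessian_le _ _ U f z v e (a + a') _ oU fC2 Uz e0) => s /eP/fmax.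
by rewrite aE a'E; lra.
Qed.

End quadratic_touching.

Section structural.
Context {R : realType} {n : nat} (Omega : set 'rV[R]_n).
Context (phi : 'rV[R]_n -> R) (Dphi : 'rV[R]_n -> 'rV[R]_n) (g : 'rV[R]_n -> R).
Context (rho lambda Lambda : R).
Context (hrho : 0 < rho) (hlambda : 0 < lambda).
Context (dom : convex_domain Omega).
Context (H : structural_conditions rho lambda Lambda Omega phi Dphi g).
Implicit Types (x y z v w : 'rV[R]_n).

Let oO : open Omega. Proof. by case: dom. Qed.

Lemma closure_dotv_le y : closure Omega y -> dotv y y <= rho ^- 2.
Proof.
move=> yO; rewrite -subr_ge0.
apply: (@continuous_ge0_closure _ _ Omega (fun y => rho ^- 2 - dotv y y)) => //.
  apply: within_continuousB; first exact: within_continuous_cst.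
  by apply: within_continuous_dotv => i; exact: within_continuous_coord.
move=> x /(bounded_domain H); rewrite /eball/= subr0 enorm_lt ?invr_gt0// exprVn.
by move=> h; rewrite subr_ge0 ltW.
Qed.

Lemma closure_diam x y : closure Omega x -> closure Omega y ->
  dotv (y - x) (y - x) <= 4 * rho ^- 2.
Proof.
move=> /closure_dotv_le xO /closure_dotv_le yO.
have := dotv_ge0 (x + y); rewrite !(dotvDl, dotvDr, dotvNl, dotvNr) (dotvC y x).
by lra.
Qed.

Lemma compact_closure : compact (closure Omega).
Proof.
apply: bounded_closed_compact; last exact: closed_closure.
exists rho^-1; split; first by rewrite num_real.
move=> M rM y /closure_dotv_le yO; apply: le_trans (ltW rM).
rewrite [leLHS]/Num.norm/= mx_normrE; apply/bigmax_leP; split; first by rewrite invr_ge0 ltW.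
move=> [i j] _ /=; rewrite ord1.
rewrite -ler_sqr ?nnegrE ?invr_ge0 ?(ltW hrho)// real_normK ?num_real// exprVn.
exact: le_trans (sqr_coord_le_dotv _ _) yO.
Qed.

Lemma phi_within_continuous : {within closure Omega, continuous phi}.
Proof.
have [M [_ ML]] := phi_lipschitz H.
pose L := Num.max (M + 1) 1.
have L0 : 0 < L by rewrite lt_max ltr01 orbT.
have ML' : M < L by rewrite lt_max ltrDl ltr01.
apply/within_continuous_cubeP => x xO e e0; exists (e / (2 * L)).
  by rewrite divr_gt0// mulr_gt0.
move=> y yO yx; have := ML L ML' (y, x) (conj yO xO) => /=.
move=> /le_lt_trans; apply.
have N : `|y - x| <= e / (2 * L).
  rewrite [leLHS]/Num.norm/= mx_normrE; apply/bigmax_leP; split.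
    by rewrite divr_ge0 ?mulr_ge0 ?ltW.
  by move=> [i j] _ /=; rewrite ord1 !mxE ltW.
apply: (@le_lt_trans _ _ (L * (e / (2 * L)))); first by rewrite ler_pM2l.
have -> : L * (e / (2 * L)) = e / 2 by field; rewrite gt_eqF.
by lra.
Qed.

Lemma Dphi_within_continuous i :
  {within closure Omega, continuous (fun x => Dphi x 0 i)}.
Proof.
have [Dc _] := phi_grad H => x.
exact: (@continuous_comp _ _ _ _ (fun v : 'rV[R]_n => v 0 i) x (Dc x)
  (@coord_continuous _ _ _ _ _ _)).
Qed.

Lemma Dphi_grad x : Omega x -> Dphi x = grad phi x.
Proof. by move=> xO; have [_] := phi_grad H; apply; exact: mem_set. Qed.

Lemma phi_convexE x y (s : R) : closure Omega x -> closure Omega y ->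
  0 <= s <= 1 -> phi (x + s *: (y - x)) <= phi x + s * (phi y - phi x).
Proof.
move=> xO yO /andP[s0 s1].
have := phi_convex H (Itv01 s0 s1) (mem_set yO) (mem_set xO).
have -> : x + s *: (y - x) = s *: y + (1 - s) *: x.
  by rewrite scalerBl scale1r scalerBr addrCA.
have -> : phi x + s * (phi y - phi x) = s * phi y + (1 - s) * phi x by ring.
by [].
Qed.

(** Compare the convexity inequality on a short segment with the first-order
expansion. *)
Lemma support_interior x y : Omega x -> closure Omega y ->
  phi x + dotv (Dphi x) (y - x) <= phi y.
Proof.
move=> xO yO; rewrite Dphi_grad//; set v := y - x.
have S0 : 0 < 1 + \sum_i `|v 0 i| by rewrite ltr_pwDl// sumr_ge0.
apply/ler_addgt0Pr => e e0.
have e'0 : 0 < e / (1 + \sum_i `|v 0 i|) by rewrite divr_gt0.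
have [d d0 dP] := C1_expansion oO (phi_C2 H).1 xO e'0.
have [d' d'0 d'P] := line_in_cube 0 v d0.
have [s [s0 s1 sd]] := exists_below ltr01 d'0.
have [|_] := dP (s *: v).
  move=> i; have := d'P s _ i; rewrite gtr0_norm// => /(_ sd).
  by rewrite add0r !mxE subr0.
rewrite dotvZr.
have -> : \sum_i `|(s *: v) 0 i| = s * \sum_i `|v 0 i|.
  by rewrite mulr_sumr; apply: eq_bigr => i _; rewrite mxE normrM gtr0_norm.
have := @phi_convexE x y s (subset_closure xO) yO; rewrite (ltW s0) (ltW s1) => /(_ isT).
rewrite -/v => c1 /ler_normlP[c2 _].
have c3 : e / (1 + \sum_i `|v 0 i|) * (s * \sum_i `|v 0 i|) <= s * e.
  rewrite mulrCA ler_pM2l// mulrAC ler_pdivrMr// ler_pM2l//.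
  by rewrite lerDr.
rewrite -(ler_pM2l s0); lra.
Qed.

(** Height of the graph above its tangent plane at [x]. *)
Definition gap x y : R := phi y - phi x - dotv (Dphi x) (y - x).

Lemma gap_ge0 x y : closure Omega x -> closure Omega y -> 0 <= gap x y.
Proof.
move=> xO yO.
apply: (@continuous_ge0_closure _ _ Omega (fun x => gap x y)) xO; last first.
  by move=> z zO; have := support_interior zO yO; rewrite /gap; lra.
apply: within_continuousB.
  apply: within_continuousB; first exact: within_continuous_cst.
  exact: phi_within_continuous.
apply: within_continuous_dotv => i; first exact: Dphi_within_continuous.
rewrite (_ : (fun z => _) = fun z : 'rV[R]_n => y 0 i - z 0 i).
  apply: within_continuousB; first exact: within_continuous_cst.
  exact: within_continuous_coord.
by apply/funext => z; rewrite !mxE.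
Qed.

Lemma gap_self x : gap x x = 0.
Proof. by rewrite /gap !subrr dotv0 subr0. Qed.

Lemma gap_within_continuous x : {within closure Omega, continuous (gap x)}.
Proof.
apply: within_continuousB.
  apply: within_continuousB; first exact: phi_within_continuous.
  exact: within_continuous_cst.
rewrite (_ : (fun y => _) = fun y => dotv (Dphi x) y - dotv (Dphi x) x).
  apply: within_continuousB; last exact: within_continuous_cst.
  by apply: continuous_subspaceT; exact: continuous_dotv.
by apply/funext => y; rewrite dotvBr.
Qed.

Definition sublevel x (s : R) : set 'rV[R]_n :=
  [set y | closure Omega y /\ gap x y <= s].

Lemma sublevel_self x (s : R) : closure Omega x -> 0 <= s -> sublevel x s x.
Proof. by move=> xO s0; split=> //; rewrite gap_self. Qed.

Lemma compact_sublevel x s : compact (sublevel x s).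
Proof.
apply: subclosed_compact compact_closure _; last by move=> y [].
apply: continuous_le_closed; first exact: closed_closure.
exact: gap_within_continuous.
Qed.

Lemma sublevel_segment x s : segment_closed (sublevel x s).
Proof.
move=> y z r [yO ys] [zO zs] r01; split; first exact: (closure_segment dom).
have := phi_convexE yO zO r01; move: ys zs; rewrite /gap.
have -> : y + r *: (z - y) - x = (y - x) + r *: ((z - x) - (y - x)).
  by rewrite opprB addrA subrK addrAC.
rewrite (dotvDr (y - x)) dotvZr (dotvBr (z - x)); case/andP: r01 => r0 r1.
set a := dotv _ (y - x); set b := dotv _ (z - x) => h1 h2 h3.
have : r * (phi z - b) <= r * (s + phi x) by rewrite ler_wpM2l//; lra.
have : (1 - r) * (phi y - a) <= (1 - r) * (s + phi x) by rewrite ler_wpM2l; lra.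
by lra.
Qed.

Lemma sublevel_interior x s : closure Omega x -> 0 < s ->
  exists (p : 'rV[R]_n) (d : R), 0 < d /\
    forall y, (forall i, `|y 0 i - p 0 i| < d) -> sublevel x s y.
Proof.
move=> xO s0; have /within_continuous_cubeP gc := @gap_within_continuous x.
have [|d d0 dP] := gc x xO (s / 2); first by rewrite divr_gt0.
have [p pO px] := (closure_cubeP _ _).1 xO d d0.
have ps : gap x p < s / 2.
  have := dP p (subset_closure pO) px.
  by rewrite gap_self subr0; apply: le_lt_trans; exact: ler_norm.
have [d1 d10 d1O] := open_cube oO pO.
have s20 : 0 < s / 2 by rewrite divr_gt0.
have [d2 d20 d2P] := gc p (subset_closure pO) (s / 2) s20.
exists p, (Num.min d1 d2); split; first by rewrite lt_min d10.
move=> y yp; have yO : Omega y.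
  by apply: d1O => i; have := yp i; rewrite lt_min => /andP[].
split; first exact: subset_closure.
have : `|gap x y - gap x p| < s / 2.
  apply: d2P; first exact: subset_closure.
  by move=> i; have := yp i; rewrite lt_min => /andP[].
by rewrite ltr_norml => *; lra.
Qed.

Let tangent x z := phi x + dotv (Dphi x) (z - x).

Let gapE x y : gap x y = phi y - tangent x y.
Proof. by rewrite /gap /tangent; ring. Qed.

Let tangent_line x z v : exists a : R, forall s : R,
  tangent x (z + s *: v) = tangent x z + a * s.
Proof.
exists (dotv (Dphi x) v) => s.
by rewrite /tangent (addrAC z (s *: v)) (dotvDr (z - x) (s *: v)) dotvZr; ring.
Qed.

(** At an interior contact point the Hessian of the quadratic would be dominated by
that of [phi], hence its determinant would be at most [Lambda]. *)
Lemma comparison x (s : R) k b (M : 'M[R]_n) :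
  (forall i j, M i j = M j i) -> (forall v, v != 0 -> 0 < qform M v) ->
  Lambda < 2 ^+ n * \det M ->
  (forall y, sublevel x s y -> bdry Omega y \/ gap x y = s ->
     quadratic k b M x y <= gap x y) ->
  forall y, sublevel x s y -> quadratic k b M x y <= gap x y.
Proof.
move=> Msym Mpos Mdet Hb y0 Ky0; rewrite leNgt; apply/negP => wy0.
pose f y := gap x y - quadratic k b M x y.
have fc : {within closure Omega, continuous f}.
  apply: within_continuousB; first exact: gap_within_continuous.
  exact: within_continuous_quadratic.
have [||z /set_mem Kz zmin] := @EVT_min_rV _ _ f (sublevel x s) _ (@compact_sublevel x s).
- by exists y0.
- by apply: continuous_subspaceW fc => y [].
have fz : f z < 0.
  by apply: le_lt_trans (zmin y0 (mem_set Ky0)) _; rewrite /f subr_lt0.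
have [zO zs] := Kz.
have nb : ~ (bdry Omega z \/ gap x z = s).
  by move=> /(Hb z Kz); move: fz; rewrite /f; lra.
have Oz : Omega z by case: (in_or_bdry dom zO) => // zb; case: nb; left.
have gz : gap x z < s.
  by rewrite lt_neqAle zs andbT; apply/eqP => E; apply: nb; right.
have [d1 d10 d1O] := open_cube oO Oz.
have /within_continuous_cubeP gc := @gap_within_continuous x.
have [|d2 d20 d2P] := gc z zO (s - gap x z); first by rewrite subr_gt0.
have Hz : forall v, 2 * qform M v <= qform (hessian phi z) v.
  have d0 : 0 < Num.min d1 d2 by rewrite lt_min d10.
  apply: (touching_below oO (phi_C2 H) Oz d0 (l := tangent x) (k := k) (b := b) (x := x)).
    exact: tangent_line.
  move=> y yz; have yO : closure Omega y.
    by apply/subset_closure/d1O => i; have := yz i; rewrite lt_min => /andP[].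
  have : `|gap x y - gap x z| < s - gap x z.
    by apply: d2P => // i; have := yz i; rewrite lt_min => /andP[].
  rewrite ltr_norml -!gapE => /andP[_ ys]; apply: zmin; apply: mem_set; split=> //.
  by lra.
have := @det_form_le _ _ (2 *: M) (hessian phi z) _ _ _.
rewrite detZ (monge_ampere_eq H Oz) => /(_ _ _ _)/andP[].
- by move=> i j; rewrite !mxE Msym.
- by move=> v v0; rewrite qformZ mulr_gt0// Mpos.
- by move=> v; rewrite qformZ.
move=> _ h; have /andP[_ gL] := monge_ampere_bounds H Oz.
by have := lt_le_trans Mdet (le_trans h gL); rewrite ltxx.
Qed.

(** Prolong the segment from a point of the domain to [y] slightly beyond [y]. *)
Lemma interior_closure_sub y (d : R) : 0 < d ->
  (forall z, (forall i, `|z 0 i - y 0 i| < d) -> closure Omega z) -> Omega y.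
Proof.
move=> d0 dO; have [_ [p pO] _] := dom.
have [e e0 eP] := line_in_cube y (y - p) d0.
pose s := e / 2; have s0 : 0 < s by rewrite divr_gt0.
have zO : closure Omega (y + s *: (y - p)).
  by apply: dO; apply: eP; rewrite gtr0_norm /s; lra.
have s1 : 0 < 1 + s by lra.
have := open_segment_in dom zO pO (s := s / (1 + s)).
rewrite divr_gt0// ler_pdivrMr// mul1r lerDr ler01 => /(_ isT).
suff -> : y + s *: (y - p) + (s / (1 + s)) *: (p - (y + s *: (y - p))) = y by [].
by apply/rowP => i; rewrite !mxE; field; rewrite gt_eqF.
Qed.

(** Inside the cell the gap stays between [0] and [t], so some quadratic of size [t]
touches it from above; at the contact point this bounds the determinant of the
Hessian of [phi], which is at least [lambda]. *)
Lemma sublevel_size_le x (t : R) (E : 'M[R]_n) (c : 'rV[R]_n) (r D : R) :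
  closure Omega x -> 0 < t -> 0 < r -> 0 < D ->
  (forall z, (forall k, `|((z - c) *m E) 0 k| <= r) -> sublevel x t z) ->
  \det (E *m E^T) = D ^- 2 ->
  lambda * D ^+ 2 <= (4 * t / r ^+ 2) ^+ n.
Proof.
move=> xO t0 r0 D0 inner detE.
pose q y := qform (E *m E^T) (y - c).
have qE y : q y = \sum_k ((y - c) *m E) 0 k ^+ 2 by rewrite /q qform_gram.
have r20 : 0 < r ^+ 2 by rewrite exprn_gt0.
have q_in y : q y <= r ^+ 2 -> sublevel x t y.
  move=> qy; apply: inner => k.
  rewrite -ler_sqr ?nnegrE ?(ltW r0)// real_normK ?num_real//.
  apply: le_trans qy; rewrite qE (bigD1 k)//= lerDl.
  by apply: sumr_ge0 => j _; exact: sqr_ge0.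
have qc A : {within A, continuous q} by exact: within_continuous_qform.
(* With this factor the quadratic takes the value [2 * t] on the boundary of the
   cell, where [gap x <= t], so the maximum below is not there. *)
pose a := 2 * t / r ^+ 2.
have a0 : 0 < a by rewrite divr_gt0// mulr_gt0.
pose f y := gap x y - a * q y.
pose B := [set y | sublevel x t y /\ q y <= r ^+ 2].
have cB : compact B.
  apply: subclosed_compact (@compact_sublevel x t) _; last by move=> y [].
  apply: continuous_le_closed => //.
  apply: continuous_le_closed; first exact: closed_closure.
  exact: gap_within_continuous.
have qcc : q c = 0 by rewrite /q subrr qform0.
have Bc : B c by split; [apply: q_in|]; rewrite qcc ltW.
have fc : {within B, continuous f}.
  apply: within_continuousB.
    by apply: continuous_subspaceW (@gap_within_continuous x) => y [[]].
  by apply: within_continuousM => //; exact: within_continuous_cst.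
have [|m /set_mem [Km qm] mmax] := @EVT_max_rV _ _ f B _ cB fc; first by exists c.
have qm' : q m < r ^+ 2.
  have := mmax c (mem_set Bc); rewrite /f qcc mulr0 subr0.
  have := gap_ge0 xO Bc.1.1; have [_] := Km => h1 h2 h3.
  have : a * q m <= t by lra.
  rewrite /a mulrAC ler_pdivrMr// => h4; nra.
have /within_continuous_cubeP qcont := qc setT.
have [|d d0 dP] := qcont m I (r ^+ 2 - q m); first by rewrite subr_gt0.
have near y : (forall i, `|y 0 i - m 0 i| < d) -> B y.
  move=> /(dP y I); rewrite ltr_norml => /andP[_ h].
  have qy : q y <= r ^+ 2 by lra.
  by split=> //; exact: q_in.
have Om : Omega m by apply: (interior_closure_sub d0) => y /near [[]].
have Hle : forall v, qform (hessian phi m) v <= 2 * qform (a *: (E *m E^T)) v.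
  apply: (touching_above oO (phi_C2 H) Om d0 (l := tangent x) (k := 0) (b := 0) (x := c)).
    exact: tangent_line.
  move=> y /near By; have := mmax y (mem_set By).
  by rewrite /f -!gapE /quadratic !dot0v !qformZ -!/(q _) !add0r.
have Hge : forall v, 0 <= qform (hessian phi m) v.
  move=> v; have -> : 0 = 2 * qform (0 : 'M[R]_n) v.
    by rewrite qformE mulmx0 mul0mx mxE mulr0.
  move: v; apply: (touching_below oO (phi_C2 H) Om d0 (l := tangent m) (k := 0) (b := 0) (x := c)).
    exact: tangent_line.
  move=> y /near [[yO _] _].
  rewrite -!gapE gap_self /quadratic !dot0v !qformE !mulmx0 !mul0mx !mxE !addr0 !subr0.
  by apply: gap_ge0 => //; exact: subset_closure.
have detH := monge_ampere_eq H Om; have /andP[gl _] := monge_ampere_bounds H Om.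
have Hsym := hessian_sym oO (phi_C2 H) Om.
have Hpos := psd_det_pos Hsym Hge.
have := @det_form_le _ _ (hessian phi m) (2 *: (a *: (E *m E^T))) Hsym (Hpos _) _.
rewrite detH !detZ detE gt_eqF; last exact: lt_le_trans gl.
move=> /(_ isT) h; have /andP[_ h2] : 0 < g m <= 2 ^+ n * (a ^+ n * D ^- 2).
  by apply: h => v; rewrite qformZ.
have := le_trans gl h2; rewrite mulrA -exprMn ler_pdivlMr ?exprn_gt0//.
by have -> : 2 * a = 4 * t / r ^+ 2 by rewrite /a; ring.
Qed.

End structural.

(** * Boundary geometry *)

Section boundary_geometry.
Context {R : realType} {n : nat} (Omega : set 'rV[R]_n).
Context (phi : 'rV[R]_n -> R) (Dphi : 'rV[R]_n -> 'rV[R]_n) (g : 'rV[R]_n -> R).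
Context (rho lambda Lambda : R).
Context (hrho : 0 < rho) (hlambda : 0 < lambda).
Context (dom : convex_domain Omega).
Context (H : structural_conditions rho lambda Lambda Omega phi Dphi g).
Implicit Types (x y z v w e nu : 'rV[R]_n).

Let oO : open Omega. Proof. by case: dom. Qed.

(** Unit normal at [z] of the interior tangent ball centred at
[z + rho *: nu]. *)
Definition ball_normal z nu : Prop :=
  dotv nu nu = 1 /\
  forall y, dotv (y - z - rho *: nu) (y - z - rho *: nu) < rho ^+ 2 -> Omega y.

Lemma exists_ball_normal z : bdry Omega z -> exists nu, ball_normal z nu.
Proof.
move=> /(interior_ball H)[c [cO cz]].
have r0 : rho != 0 by rewrite gt_eqF.
have cz2 : dotv (c - z) (c - z) = rho ^+ 2.
  by rewrite -cz sqr_enorm -(opprB z c) dotvNl dotvNr opprK.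
exists (rho^-1 *: (c - z)); split.
  by rewrite dotvZl dotvZr cz2; field.
move=> y; rewrite scalerA mulfV// scale1r opprB addrA subrK => yc.
by apply: cO; rewrite /eball/= enorm_lt.
Qed.

Section at_boundary_point.
Context (z nu : 'rV[R]_n) (zb : bdry Omega z) (bn : ball_normal z nu).

Let nu1 : dotv nu nu = 1. Proof. by case: bn. Qed.

Let cz : closure Omega z. Proof. by case/(bdryE dom): zb. Qed.

(** A point of the closure below the tangent hyperplane would, together with
the tangent ball, enclose [z] in the convex domain. *)
Lemma normal_ge0 y : closure Omega y -> 0 <= dotv nu (y - z).
Proof.
move=> yO; rewrite leNgt; apply/negP => h0.
set h := dotv nu (y - z) in h0; set Y := dotv (y - z) (y - z).
have Y0 : 0 < Y.
  rewrite /Y dotv_gt0//; apply/eqP => yz; move: h0.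
  by rewrite /h yz dotv0 ltxx.
pose s := rho * - h / Y.
have s0 : 0 < s by rewrite divr_gt0// mulr_gt0// oppr_gt0.
have qO : Omega (z - s *: (y - z)).
  apply: bn.2; rewrite (addrAC z) subrr add0r -scaleNr dotv_sqrB !dotv_sqrZ.
  rewrite dotvZl dotvZr (dotvC (y - z) nu) nu1 -/h -/Y -subr_gt0.
  have -> : rho ^+ 2 - ((- s) ^+ 2 * Y - 2 * (- s * (rho * h)) + rho ^+ 2 * 1) =
     s * (- 2 * rho * h - s * Y) by ring.
  rewrite mulr_gt0// /s divfK ?gt_eqF//.
  have : 0 < rho * - h by rewrite mulr_gt0// oppr_gt0.
  lra.
case/(bdryE dom): (zb) => _; apply.
have s1 : 0 < 1 + s by lra.
have := open_segment_in dom yO qO (s := (1 + s)^-1).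
rewrite invr_gt0 s1 invf_le1// lerDl (ltW s0) => /(_ isT).
suff -> : y + (1 + s)^-1 *: (z - s *: (y - z) - y) = z by [].
by apply/rowP => i; rewrite !mxE; field; rewrite gt_eqF.
Qed.

Lemma normal_gt0 y : Omega y -> 0 < dotv nu (y - z).
Proof.
move=> yO; have [d d0 dO] := open_cube oO yO.
have [e e0 eP] := line_in_cube y nu d0.
have yO' : Omega (y + (- (e / 2)) *: nu).
  by apply: dO; apply: eP; rewrite normrN gtr0_norm; lra.
have := normal_ge0 (subset_closure yO').
by rewrite addrAC (dotvDr (y - z)) dotvZr nu1; lra.
Qed.

Lemma normal_le_bdry y : bdry Omega y ->
  2 * rho * dotv nu (y - z) <= dotv (y - z) (y - z).
Proof.
case/(bdryE dom) => _ yO; rewrite leNgt; apply/negP => h; apply: yO; apply: bn.2.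
rewrite dotv_sqrB dotv_sqrZ dotvZr (dotvC (y - z) nu) nu1; lra.
Qed.

(** Points of the boundary above the tangent hyperplane: the hyperplane misses
the domain, while the ball is in it at height [r ^+ 2 / rho]. *)
Lemma bdry_above_tangent e (r : R) : dotv e e = 1 -> dotv nu e = 0 ->
  0 < r < rho -> exists gamma : R, 0 <= gamma <= r ^+ 2 / rho /\
    bdry Omega (z + r *: e + gamma *: nu).
Proof.
move=> e1 nue /andP[r0 rr]; pose G := r ^+ 2 / rho.
have G0 : 0 < G by rewrite divr_gt0// exprn_gt0.
have O1 : Omega (z + r *: e + G *: nu).
  apply: bn.2; rewrite !(addrAC _ _ (- z)) subrr add0r -addrA -scalerBl.
  rewrite dotv_sqrD !dotv_sqrZ dotvZl dotvZr e1 nu1 (dotvC e nu) nue -subr_gt0.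
  have -> : rho ^+ 2 - (r ^+ 2 * 1 + 2 * (r * ((G - rho) * 0)) + (G - rho) ^+ 2 * 1)
     = G * (rho - G) by rewrite /G; field; rewrite gt_eqF.
  rewrite mulr_gt0// subr_gt0 /G ltr_pdivrMr//.
  by rewrite -expr2 ltr_sqr// nnegrE ltW.
have O0 : ~ Omega (z + r *: e).
  by move=> /normal_gt0; rewrite addrAC subrr add0r dotvZr nue mulr0 ltxx.
have [s /andP[s0 s1] sb] := segment_meets_bdry dom O1 O0.
exists ((1 - s) * G); split.
  rewrite -/G; apply/andP; split; first by rewrite mulr_ge0 ?subr_ge0// ltW.
  by rewrite ler_piMl// ?(ltW G0)//; lra.
suff -> : z + r *: e + ((1 - s) * G) *: nu = z + r *: e + G *: nu +
  s *: (z + r *: e - (z + r *: e + G *: nu)) by [].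
by apply/rowP => i; rewrite !mxE; ring.
Qed.

Lemma gap_bdry y : bdry Omega y ->
  rho * dotv (y - z) (y - z) <= gap phi Dphi z y <=
    rho^-1 * dotv (y - z) (y - z).
Proof. by move=> yb; have := quadratic_separation H yb zb; rewrite sqr_enorm. Qed.

(** The gradient is extended continuously to the boundary, so the gap is
sublinear along the normal. *)
Lemma gap_sublinear (l s : R) : 0 < l -> 0 < s ->
  exists2 y, sublevel Omega phi Dphi z s y &
    gap phi Dphi z y < l * dotv nu (y - z).
Proof.
move=> l0 s0.
have Fc : {within closure Omega, continuous (fun y => dotv nu (Dphi y))}.
  apply: within_continuous_dotv => i; first exact: within_continuous_cst.
  exact: (Dphi_within_continuous H).
have [d d0 dP] := (within_continuous_cubeP _ _).1 Fc z cz l l0.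
have [e e0 eP] := line_in_cube z nu d0.
have sl : 0 < s / l by rewrite divr_gt0.
have [m [m0 mr ms]] := exists_below hrho sl.
have [h [h0 he hm]] := exists_below e0 m0.
have [hr hs] : h < rho /\ h < s / l by split; apply: lt_trans hm _.
pose y := z + h *: nu.
have yz : y - z = h *: nu by rewrite /y addrAC subrr add0r.
have yO : Omega y.
  apply: bn.2; rewrite yz -scalerBl dotv_sqrZ nu1 mulr1 -sqrrN opprB.
  by rewrite ltr_sqr ?nnegrE; lra.
have g1 : gap phi Dphi z y < l * h.
  have := support_interior dom H yO cz.
  rewrite -(opprB y z) dotvNr /gap yz !dotvZr => h1.
  have := dP y (subset_closure yO) (eP h _); rewrite gtr0_norm// => /(_ he).
  rewrite ltr_norml (dotvC nu) (dotvC nu) => /andP[_ h2].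
  have : h * (dotv (Dphi y) nu - dotv (Dphi z) nu) < h * l by rewrite ltr_pM2l.
  by lra.
exists y; last by rewrite yz dotvZr nu1 mulr1.
split; first exact: subset_closure.
by apply: le_trans (ltW g1) _; rewrite mulrC -ler_pdivlMr// ltW.
Qed.

End at_boundary_point.

Lemma closed_bdry : closed (bdry Omega).
Proof.
apply: closedI; first exact: closed_closure.
exact/open_closedC/open_interior.
Qed.

Lemma compact_bdry : compact (bdry Omega).
Proof. by apply: subclosed_compact closed_bdry (compact_closure hrho H) _ => y []. Qed.

Lemma bdry_nonempty : (0 < n)%N -> bdry Omega !=set0.
Proof.
move=> n0; have [_ [p pO] _] := dom; pose i := Ordinal n0.
pose q : 'rV[R]_n := const_mx (2 / rho).
have qO : ~ Omega q.
  move=> /subset_closure/(closure_dotv_le hrho H) h.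
  have := le_trans (sqr_coord_le_dotv q i) h.
  rewrite mxE exprMn exprVn => {}h.
  have r2 : 0 < rho ^- 2 by rewrite invr_gt0 exprn_gt0.
  by have : 2 ^+ 2 * rho ^- 2 - rho ^- 2 = 3 * rho ^- 2 by [ring]; lra.
by have [s _ sb] := segment_meets_bdry dom pO qO; eexists; exact: sb.
Qed.

(** Since the gap of [x] is least at [z] among boundary points, its gradient there has
no tangential part; since it vanishes at [x], which is on the inner side, the
normal part points outwards or is zero. *)
Lemma gap_min_normal x z : closure Omega x -> bdry Omega z ->
  (forall y, bdry Omega y -> gap phi Dphi x z <= gap phi Dphi x y) ->
  forall y, closure Omega y -> dotv (Dphi z - Dphi x) (y - z) <= 0.
Proof.
move=> xO zb zmin; have [nu bn] := exists_ball_normal zb.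
have nu1 := bn.1; have [zO _] := (bdryE dom z).1 zb.
set w0 := Dphi z - Dphi x.
have gapD y : gap phi Dphi x y - gap phi Dphi x z = gap phi Dphi z y + dotv w0 (y - z).
  rewrite /gap /w0 dotvBl.
  have -> : y - x = (y - z) + (z - x) by rewrite addrA subrK.
  by rewrite (dotvDr (y - z) (z - x) (Dphi x)); ring.
pose a := dotv w0 nu; pose w' := w0 - a *: nu.
have w'nu : dotv nu w' = 0 by rewrite /w' dotvBr dotvZr nu1 (dotvC nu) mulr1 subrr.
(* To first order the gap of [x] varies along the boundary like [dotv w'], the rest
   being quadratic; it has a minimum at [z]. *)
have w'0 : w' = 0.
  apply/eqP; apply/negP => /negP w'n0; have W0 := dotv_gt0 w'n0.
  pose b := enorm w'; have b2 : b ^+ 2 = dotv w' w' by rewrite sqr_enorm.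
  have b0 : 0 < b by rewrite lt_neqAle enorm_ge0 andbT eq_sym -sqrf_eq0 b2 gt_eqF.
  pose e := (- b^-1) *: w'.
  have e1 : dotv e e = 1 by rewrite dotv_sqrZ -b2; field; rewrite gt_eqF.
  have nue : dotv nu e = 0 by rewrite dotvZr w'nu mulr0.
  have we : dotv w0 e = - b.
    have -> : w0 = w' + a *: nu by rewrite subrK.
    rewrite dotvDl (dotvZl a) nue mulr0 addr0 /e dotvZr -b2; field.
    by rewrite gt_eqF.
  clearbody e; have a2 : 0 < 2 + `|a| by rewrite ltr_pwDl.
  have br : 0 < b * rho / (2 + `|a|) by rewrite divr_gt0// mulr_gt0.
  have [r [r0 rr rb]] := exists_below hrho br.
  have [|G [/andP[G0 Gr] yb]] := bdry_above_tangent zb bn e1 nue (r := r).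
    by rewrite r0.
  have := zmin _ yb; rewrite -subr_ge0 gapD.
  have /andP[_] := gap_bdry zb yb.
  set y := z + _ + _; have yz : y - z = r *: e + G *: nu.
    by apply/rowP => i; rewrite /y !mxE; ring.
  rewrite yz dotv_sqrD !dotv_sqrZ dotvZl dotvZr (dotvC e nu) nue e1 nu1.
  rewrite (dotvDr (r *: e)) !dotvZr we -/a => h1 h2.
  have Gr2 : G ^+ 2 <= r ^+ 2.
    rewrite ler_sqr ?nnegrE ?(ltW r0)//; apply: le_trans Gr _.
    by rewrite ler_pdivrMr// expr2 ler_pM2l// ltW.
  have aG : a * G <= `|a| * (r ^+ 2 / rho).
    by apply: le_trans (ler_norm _) _; rewrite normrM ler_wpM2l// ger0_norm.
  have h3 : r * b <= r * (r * (2 + `|a|) / rho).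
    have : rho^-1 * (r ^+ 2 + G ^+ 2) <= rho^-1 * (r ^+ 2 + r ^+ 2).
      by rewrite ler_pM2l ?invr_gt0// lerD2l.
    have -> : r * (r * (2 + `|a|) / rho) =
      rho^-1 * (r ^+ 2 + r ^+ 2) + `|a| * (r ^+ 2 / rho) by ring.
    by lra.
  move: h3; rewrite ler_pM2l// ler_pdivlMr// leNgt -ltr_pdivlMr//.
  by rewrite rb.
have w0E : w0 = a *: nu by apply/eqP; rewrite -subr_eq0 -/w' w'0.
have h0 := normal_ge0 zb bn xO.
have ax : a * dotv nu (x - z) <= 0.
  have := gapD x; rewrite gap_self sub0r w0E dotvZl => E.
  have := gap_ge0 dom H xO zO; have := gap_ge0 dom H zO xO; lra.
move=> y yO; rewrite w0E dotvZl; have hy := normal_ge0 zb bn yO.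
have [hx|hx] := ltP 0 (dotv nu (x - z)).
  by rewrite pmulr_lle0// in ax; rewrite mulr_le0_ge0.
have xb : bdry Omega x.
  have [Ox|//] := in_or_bdry dom xO.
  by have := normal_gt0 zb bn Ox; rewrite ltNge hx.
have xz : x = z.
  have := zmin _ xb; rewrite gap_self.
  have /andP[h1 _] := gap_bdry xb zb => h2.
  have : rho * dotv (z - x) (z - x) <= 0 by apply: le_trans h1 h2.
  rewrite pmulr_rle0// => h3.
  have /dotv_eq0/eqP : dotv (z - x) (z - x) = 0.
    by apply/eqP; rewrite eq_le h3 dotv_ge0.
  by rewrite subr_eq0 => /eqP.
have -> : a = 0 by rewrite /a /w0 xz subrr dot0v.
by rewrite mul0r.
Qed.

End boundary_geometry.

(** * Lower bound *)

Section lower_bound.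
Context {R : realType} {n : nat} (Omega : set 'rV[R]_n).
Context (phi : 'rV[R]_n -> R) (Dphi : 'rV[R]_n -> 'rV[R]_n) (g : 'rV[R]_n -> R).
Context (rho lambda Lambda : R).
Context (n0 : (0 < n)%N) (hrho : 0 < rho) (hlambda : 0 < lambda) (hLambda : 0 < Lambda).
Context (dom : convex_domain Omega).
Context (H : structural_conditions rho lambda Lambda Omega phi Dphi g).
Implicit Types (x y z v w e nu : 'rV[R]_n).

Local Notation K := (sublevel Omega phi Dphi).
Local Notation gp := (gap phi Dphi).

(** The weight on the normal direction for which [a%:M + b *: nu^T *m nu] has
enough Monge-Ampere mass to be a barrier. *)
Definition slab_weight (a : R) : R := a * Lambda / (2 * a) ^+ n.

Lemma slab_weight_gt0 a : 0 < a -> 0 < slab_weight a.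
Proof. by move=> a0; rewrite divr_gt0 ?exprn_gt0 ?mulr_gt0. Qed.

Lemma slab_comparison x nu (s a l : R) : dotv nu nu = 1 -> 0 < a ->
  (forall y, K x s y -> bdry Omega y \/ gp x y = s ->
     a * dotv (y - x) (y - x) + slab_weight a * dotv nu (y - x) ^+ 2
       + l * dotv nu (y - x) <= gp x y) ->
  forall y, K x s y ->
     a * dotv (y - x) (y - x) + slab_weight a * dotv nu (y - x) ^+ 2
       + l * dotv nu (y - x) <= gp x y.
Proof.
move=> nu1 a0; set b := slab_weight a.
have b0 : 0 < b := slab_weight_gt0 a0.
pose M := a%:M + b *: (nu^T *m nu).
have ME v : qform M v = a * dotv v v + b * dotv nu v ^+ 2.
  by rewrite /M qformD qformZ qform_tensor -scalemx1 qformZ qform1.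
have quadE y : a * dotv (y - x) (y - x) + b * dotv nu (y - x) ^+ 2 +
    l * dotv nu (y - x) = quadratic 0 (l *: nu) M x y.
  by rewrite /quadratic ME dotvZl; ring.
move=> Hb y Ky; rewrite quadE; apply: (comparison hrho dom H) Ky => //.
- move=> i j; rewrite !mxE !big_ord1 !mxE (eq_sym i) mulrC.
  by rewrite (mulrC (nu 0 i)) [nu 0 j * _ * b]mulrC.
- move=> v v0; rewrite ME ltr_pwDl ?mulr_gt0 ?dotv_gt0//.
  by rewrite mulr_ge0 ?sqr_ge0// ltW.
- rewrite det_scalar_add_tensor ?gt_eqF// nu1 mulr1 mulrA -exprMn /b /slab_weight.
  have A0 : 0 < (2 * a) ^+ n by rewrite exprn_gt0// mulr_gt0.
  have -> : (2 * a) ^+ n * (1 + a * Lambda / (2 * a) ^+ n / a) = (2 * a) ^+ n + Lambda.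
    by move: ((2 * a) ^+ n) A0 => A A0; field; rewrite !gt_eqF.
  by rewrite ltrDr.
- by move=> z Kz zb; rewrite -quadE; exact: Hb.
Qed.

(** Downward slope that makes the normal part of the slab barrier nonpositive on
the whole domain, whose diameter is at most [2 / rho]. *)
Definition tilt : R := slab_weight (rho / 2) * (2 / rho).

Lemma tilt_gt0 : 0 < tilt.
Proof. by apply: mulr_gt0; [apply: slab_weight_gt0|]; rewrite divr_gt0. Qed.

Section at_boundary_point.
Context (x nu : 'rV[R]_n) (xb : bdry Omega x) (bn : ball_normal Omega rho x nu).

Let nu1 : dotv nu nu = 1. Proof. by case: bn. Qed.
Let xO : closure Omega x. Proof. by case/(bdryE dom): xb. Qed.

Local Notation d2 y := (dotv (y - x) (y - x)).
Local Notation h y := (dotv nu (y - x)).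

Let d2_ge0 y : 0 <= d2 y. Proof. exact: dotv_ge0. Qed.

Let h_ge0 y : closure Omega y -> 0 <= h y.
Proof. exact: (normal_ge0 hrho dom xb bn). Qed.

Let h_le y : closure Omega y -> h y <= 2 / rho.
Proof.
move=> yO; rewrite -ler_sqr ?nnegrE ?h_ge0 ?divr_ge0 ?(ltW hrho)//.
apply: le_trans (cauchy_schwarz _ _) _; rewrite nu1 mul1r.
apply: le_trans (closure_diam hrho H xO yO) _.
by rewrite exprMn exprVn -natrX.
Qed.

Let h_le_d2 y : bdry Omega y -> h y <= d2 y / (2 * rho).
Proof.
move=> yb; have := normal_le_bdry dom bn yb.
by rewrite ler_pdivlMr ?mulr_gt0// mulrC.
Qed.

Let gap_le_d2 y : bdry Omega y -> rho * d2 y <= gp x y.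
Proof. by move=> yb; have /andP[] := gap_bdry H xb yb. Qed.

Let bdry_closure y : bdry Omega y -> closure Omega y.
Proof. by case/(bdryE dom). Qed.

(** Comparison with the slab barrier of slope [- tilt] on the whole closure. On a
sublevel set it bounds the distance to [x] by the height over the tangent plane. *)
Lemma d2_le_gap y : closure Omega y -> rho / 2 * d2 y <= gp x y + tilt * h y.
Proof.
move=> yO; have a0 : 0 < rho / 2 by rewrite divr_gt0.
have [||m /set_mem mO mmax] := @EVT_max_rV _ _ (gp x) (closure Omega) _
   (compact_closure hrho H).
- by exists x.
- exact: (gap_within_continuous H).
have b0 := slab_weight_gt0 a0.
have := @slab_comparison x nu (gp x m + 1) (rho / 2) (- tilt) nu1 a0 _ y.
have bh0 : 0 <= slab_weight (rho / 2) * h y ^+ 2 by rewrite mulr_ge0 ?sqr_ge0// ltW.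
suff P : forall z, K x (gp x m + 1) z -> bdry Omega z \/ gp x z = gp x m + 1 ->
   rho / 2 * d2 z + slab_weight (rho / 2) * h z ^+ 2 + - tilt * h z <= gp x z.
  move=> /(_ P); have Ky : K x (gp x m + 1) y.
    by split=> //; have := mmax y (mem_set yO); lra.
  by move=> /(_ Ky); lra.
move=> z [zO _] [zb|zm]; last first.
  by have := mmax z (mem_set zO); lra.
have h1 : slab_weight (rho / 2) * h z ^+ 2 <= tilt * h z.
  rewrite /tilt expr2 mulrA; apply: ler_wpM2r; first exact: h_ge0.
  by rewrite ler_pM2l// h_le.
have h2 := gap_le_d2 zb; have h3 := d2_ge0 z.
have : rho / 2 * d2 z <= rho * d2 z by rewrite ler_wpM2r//; lra.
lra.
Qed.

(** Constants of [exists_high_point]: [steepness] is the multiple of [s] that a high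
point has to reach for [bdry_slope_le], [slab_width * s] bounds [|y - x| ^ 2] on a
sublevel set without high points, [slab_coef] is the coefficient of the barrier
there, and [threshold] bounds the heights [s] for which its second-order terms are
negligible. *)
Definition steepness : R := Num.max 1 (4 / rho ^+ 2 * (1 + tilt)).
Definition slab_width : R := 2 / rho * (1 + tilt * steepness).
Definition slab_coef : R := Num.min (rho / 4) (4 * slab_width)^-1.
Definition threshold : R :=
  Num.min rho (Num.min (4 * slab_weight slab_coef * steepness ^+ 2)^-1
    (rho ^+ 2 / (2 * slab_weight slab_coef * steepness))).

Lemma steepness_gt0 : 0 < steepness.
Proof. by rewrite lt_max ltr01. Qed.

Lemma slab_width_gt0 : 0 < slab_width.
Proof.
rewrite mulr_gt0 ?divr_gt0// ltr_pwDl// mulr_ge0// ltW//; [exact: tilt_gt0|].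
exact: steepness_gt0.
Qed.

Lemma slab_coef_gt0 : 0 < slab_coef.
Proof.
by rewrite lt_min divr_gt0// invr_gt0 mulr_gt0// slab_width_gt0.
Qed.

Lemma threshold_gt0 : 0 < threshold.
Proof.
have b0 := slab_weight_gt0 slab_coef_gt0; have k0 := steepness_gt0.
rewrite /threshold !lt_min hrho invr_gt0/=; apply/andP; split.
  by apply: mulr_gt0; [exact: mulr_gt0|exact: exprn_gt0].
by apply: divr_gt0; [exact: exprn_gt0|apply: mulr_gt0 => //; exact: mulr_gt0].
Qed.

(** If the sublevel set lay in the slab of width [steepness * s], it would be so
confined that a fixed barrier with positive normal slope would be below the gap,
against [gap_sublinear]. *)
Lemma exists_high_point (s : R) : 0 < s -> s <= threshold ->
  exists2 p, K x s p & steepness * s < h p.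
Proof.
move=> s0; rewrite /threshold !le_min => /and3P[_ s1 s2].
set k := steepness in s1 s2 *; set a := slab_coef in s1 s2 *.
set b := slab_weight a in s1 s2 *; set C := slab_width.
have k0 : 0 < k := steepness_gt0; have a0 : 0 < a := slab_coef_gt0.
have b0 : 0 < b := slab_weight_gt0 a0; have C0 : 0 < C := slab_width_gt0.
have N0 := tilt_gt0; have four : 0 < 4 :> R by []; have two : 0 < 2 :> R by [].
have C4 : 0 < 4 * C := mulr_gt0 four C0.
have k4 : 0 < 4 * k := mulr_gt0 four k0.
have bk4 : 0 < 4 * b * k ^+ 2 := mulr_gt0 (mulr_gt0 four b0) (exprn_gt0 2 k0).
have bk2 : 0 < 2 * b * k := mulr_gt0 (mulr_gt0 two b0) k0.
apply: contrapT => nex.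
have hk y : K x s y -> h y <= k * s.
  by move=> Ky; rewrite leNgt; apply/negP => hy; apply: nex; exists y.
have dC y : K x s y -> d2 y <= C * s.
  move=> Ky; have := d2_le_gap Ky.1; have := hk y Ky; have := Ky.2 => h1 h2 h3.
  have : tilt * h y <= tilt * (k * s) by rewrite ler_pM2l.
  move=> h4; have h5 : rho / 2 * d2 y <= s + tilt * (k * s) by lra.
  rewrite -(ler_pM2l (_ : 0 < rho / 2)) ?divr_gt0//; apply: le_trans h5 _.
  rewrite le_eqVlt; apply/orP; left; apply/eqP.
  by rewrite /C /slab_width -/k; field; rewrite gt_eqF.
have [ar aC] : a <= rho / 4 /\ a * (4 * C) <= 1.
  split; first by rewrite /a /slab_coef ge_min lexx.
  by rewrite -ler_pdivlMr// div1r /a /slab_coef ge_min lexx orbT.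
pose l := Num.min (rho ^+ 2 / 2) (4 * k)^-1.
have l0 : 0 < l by rewrite lt_min divr_gt0 ?exprn_gt0// invr_gt0.
have [lr lk] : l <= rho ^+ 2 / 2 /\ l * (4 * k) <= 1.
  split; first by rewrite /l ge_min lexx.
  by rewrite -ler_pdivlMr// div1r /l ge_min lexx orbT.
have sb1 : s * (4 * b * k ^+ 2) <= 1.
  by rewrite -ler_pdivlMr// div1r.
have sb2 : s * (2 * b * k) <= rho ^+ 2 by rewrite -ler_pdivlMr.
have Hb : forall y, K x s y -> bdry Omega y \/ gp x y = s ->
    a * d2 y + b * h y ^+ 2 + l * h y <= gp x y.
  move=> y Ky yb; have hy := hk y Ky; have dy := dC y Ky; have hy0 := h_ge0 Ky.1.
  case: yb => [yb|->]; last first.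
    have e1 : a * d2 y <= s / 4.
      have : a * d2 y <= a * (C * s) by rewrite ler_pM2l.
      have : (a * (4 * C)) * s <= 1 * s by rewrite ler_pM2r.
      lra.
    have e2 : b * h y ^+ 2 <= s / 4.
      have : h y ^+ 2 <= (k * s) ^+ 2.
        by rewrite ler_sqr// nnegrE mulr_ge0// ltW.
      move=> q1; have : b * h y ^+ 2 <= b * (k * s) ^+ 2 by rewrite ler_pM2l.
      have : (s * (4 * b * k ^+ 2)) * s <= 1 * s by rewrite ler_pM2r.
      lra.
    have e3 : l * h y <= s / 4.
      have : l * h y <= l * (k * s) by rewrite ler_pM2l.
      have : (l * (4 * k)) * s <= 1 * s by rewrite ler_pM2r.
      lra.
    lra.
  have hd := h_le_d2 yb; have gd := gap_le_d2 yb; have d0 := d2_ge0 y.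
  have hd' : rho * h y <= d2 y / 2.
    by move: hd; rewrite ler_pdivlMr ?mulr_gt0//; lra.
  have e1 : a * d2 y <= rho / 4 * d2 y by rewrite ler_wpM2r.
  have e2 : b * h y ^+ 2 <= rho / 4 * d2 y.
    have q1 : b * h y ^+ 2 <= b * (k * s) * h y.
      by rewrite expr2 mulrA ler_wpM2r// ler_pM2l.
    have q2 : (s * (2 * b * k)) * h y <= rho ^+ 2 * h y by rewrite ler_wpM2r.
    have q3 : rho * (rho * h y) <= rho * (d2 y / 2) by rewrite ler_pM2l.
    lra.
  have e3 : l * h y <= rho / 4 * d2 y.
    have q1 : l * h y <= rho ^+ 2 / 2 * h y by rewrite ler_wpM2r.
    have q3 : rho * (rho * h y) <= rho * (d2 y / 2) by rewrite ler_pM2l.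
    lra.
  have rd : 0 <= rho * d2 y by rewrite mulr_ge0// ltW.
  lra.
have low := slab_comparison nu1 a0 Hb.
have [y Ky] := gap_sublinear hrho dom H xb bn l0 s0.
rewrite ltNge => /negP; apply; apply: le_trans (low y Ky).
rewrite lerDr; apply: addr_ge0; apply: mulr_ge0; rewrite ?sqr_ge0 ?(ltW b0)//.
exact: ltW.
Qed.

Definition slope_bound : R := 144 / rho + 32 / rho ^+ 3.

(** Along a tangent vector the coordinate [dotv v] varies by at most [2] over a length
[sqrt s], because the sublevel set contains a piece of the boundary of that size.
The high point controls the normal component, which boundary points only see at
second order. *)
Lemma bdry_slope_le (s : R) v : 0 < s -> s <= threshold ->
  (forall y z, K x s y -> K x s z -> `|dotv v (y - z)| <= 2) ->
  forall y, bdry Omega y -> K x s y ->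
    dotv v (y - x) ^+ 2 <= slope_bound * d2 y / s.
Proof.
move=> s0 st vK; have [p Kp hp] := exists_high_point s0 st.
have sr : s <= rho by move: st; rewrite /threshold le_min => /andP[].
have Kx : K x s x by apply: sublevel_self => //; exact: ltW.
pose a := dotv v nu; pose v' := v - a *: nu; pose b := enorm v'.
have v'nu : dotv nu v' = 0 by rewrite dotvBr dotvZr nu1 (dotvC nu) mulr1 subrr.
have b0 : 0 <= b := enorm_ge0 _; have b2 : b ^+ 2 = dotv v' v' := sqr_enorm _.
have vE w : dotv v w = dotv v' w + a * dotv nu w.
  have {1}-> : v = v' + a *: nu by rewrite subrK.
  by rewrite dotvDl dotvZl.
have v'd y : `|dotv v' (y - x)| ^+ 2 <= b ^+ 2 * d2 y.
  by rewrite real_normK ?num_real// b2; exact: cauchy_schwarz.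
(* Boundary points over the tangent vectors of length [r] are in the sublevel set. *)
pose r := Num.sqrt (rho * s / 2).
have r2 : r ^+ 2 = rho * s / 2 by rewrite sqr_sqrtr// divr_ge0// mulr_ge0 ?ltW.
have r0 : 0 < r by rewrite sqrtr_gt0 divr_gt0// mulr_gt0.
have rr : r < rho.
  rewrite -ltr_sqr ?nnegrE ?(ltW r0) ?(ltW hrho)// r2 expr2 -mulrA ltr_pM2l//.
  lra.
pose X := s * `|a|.
have X0 : 0 <= X by rewrite mulr_ge0// ltW.
(* [b] and [a] are the tangential and normal components of [v]. *)
have tang : r * b <= 2 + X / 2.
  have [bz|bn0] := eqVneq b 0; first by rewrite bz mulr0; lra.
  have bp : 0 < b by rewrite lt_neqAle eq_sym bn0.
  have [e [e1 nue ve]] : exists e, [/\ dotv e e = 1, dotv nu e = 0 & dotv v e = b].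
    exists (b^-1 *: v'); split.
    - by rewrite dotv_sqrZ -b2; field.
    - by rewrite dotvZr v'nu mulr0.
    - by rewrite vE !dotvZr v'nu -b2; field.
  have [|G [/andP[G0 Gr] yb]] := bdry_above_tangent hrho dom xb bn e1 nue (r := r).
    by rewrite r0.
  set y := x + r *: e + G *: nu in yb.
  have yx : y - x = r *: e + G *: nu.
    by apply/rowP => i; rewrite /y !mxE; ring.
  have GE : r ^+ 2 / rho = s / 2 by rewrite r2; field; rewrite gt_eqF.
  have d2y : d2 y = r ^+ 2 + G ^+ 2.
    by rewrite yx dotv_sqrD !dotv_sqrZ dotvZl dotvZr (dotvC e nu) nue e1 nu1; ring.
  have Ky : K x s y.
    split; first exact: bdry_closure.
    have /andP[_ h2] := gap_bdry H xb yb; apply: le_trans h2 _.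
    rewrite d2y.
    have : G ^+ 2 <= r ^+ 2.
      rewrite ler_sqr ?nnegrE ?(ltW r0)//; apply: le_trans Gr _.
      by rewrite ler_pdivrMr// expr2 ler_pM2l// ltW.
    move=> q1; rewrite ler_pdivrMl//; lra.
  have := vK y x Ky Kx; rewrite yx dotvDr !dotvZr ve -/a.
  move=> /ler_normlP[_ q1].
  have : - (G * a) <= s / 2 * `|a|.
    apply: le_trans (ler_norm _) _; rewrite normrN normrM ger0_norm//.
    by rewrite ler_wpM2r// -GE.
  rewrite /X; lra.
have k1 : 1 <= steepness by rewrite le_max lexx.
have k2 : 4 / rho ^+ 2 * (1 + tilt) <= steepness by rewrite le_max lexx orbT.
pose q := h p / s.
have hq : h p = q * s by rewrite divfK// gt_eqF.
have kq : steepness < q by rewrite ltr_pdivlMr.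
have q1 : 1 <= q by lra.
have N0 := tilt_gt0.
have pd : r ^- 2 * d2 p <= q ^+ 2.
  have q2 : rho / 2 * d2 p <= s * (1 + tilt * q).
    have := d2_le_gap Kp.1; have := Kp.2; rewrite hq; lra.
  have q3 : r ^- 2 * d2 p <= 4 / rho ^+ 2 * (1 + tilt * q).
    rewrite r2 ler_pdivrMl ?divr_gt0 ?mulr_gt0//.
    rewrite -(ler_pM2l (_ : 0 < rho / 2)) ?divr_gt0//; apply: le_trans q2 _.
    by rewrite le_eqVlt; apply/orP; left; apply/eqP; field; rewrite gt_eqF.
  apply: le_trans q3 _.
  have q4 : 0 < 4 / rho ^+ 2 by rewrite divr_gt0// exprn_gt0.
  have : 4 / rho ^+ 2 * (1 + tilt * q) <= 4 / rho ^+ 2 * ((1 + tilt) * q).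
    by rewrite ler_pM2l//; lra.
  move=> /le_trans; apply; rewrite mulrA expr2 ler_pM2r; last by lra.
  lra.
have bdp : `|dotv v' (p - x)| <= (2 + X / 2) * q.
  rewrite -ler_sqr ?nnegrE//; last by rewrite mulr_ge0//; lra.
  apply: le_trans (v'd p) _.
  have -> : b ^+ 2 * d2 p = (r * b) ^+ 2 * (r ^- 2 * d2 p).
    by field; rewrite gt_eqF.
  rewrite [leRHS]exprMn; apply: ler_pM => //.
  - exact: sqr_ge0.
  - by apply: mulr_ge0; rewrite ?dotv_ge0// invr_ge0 sqr_ge0.
  - by rewrite ler_sqr ?nnegrE// ?mulr_ge0 ?(ltW r0)//; lra.
have X8 : X <= 8.
  have := vK p x Kp Kx; rewrite vE hq => q2.
  have : `|a * (q * s)| <= 2 + (2 + X / 2) * q.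
    have -> : a * (q * s) = (dotv v' (p - x) + a * (q * s)) - dotv v' (p - x) by ring.
    by apply: le_trans (ler_normB _ _) _; lra.
  rewrite normrM (ger0_norm (_ : 0 <= q * s)); last by rewrite mulr_ge0; lra.
  have -> : `|a| * (q * s) = X * q by rewrite /X; ring.
  move=> q3; rewrite -(ler_pM2r (_ : 0 < q / 2)); lra.
have rb : r * b <= 6 by lra.
move=> y yb [yO ys]; have hy := h_le_d2 yb; have hy0 := h_ge0 yO.
have dy := d2_ge0 y.
have ds : rho * d2 y <= s by apply: le_trans (gap_le_d2 yb) ys.
rewrite vE ler_pdivlMr//.
have e1 : dotv v' (y - x) ^+ 2 * s <= 72 / rho * d2 y.
  have : dotv v' (y - x) ^+ 2 <= b ^+ 2 * d2 y by rewrite b2; exact: cauchy_schwarz.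
  move=> c1; have : (r * b) ^+ 2 <= 6 ^+ 2.
    by rewrite ler_sqr ?nnegrE ?mulr_ge0 ?(ltW r0).
  rewrite exprMn r2 => c2.
  have c3 : dotv v' (y - x) ^+ 2 * s <= b ^+ 2 * d2 y * s by rewrite ler_pM2r.
  apply: le_trans c3 _.
  have c4 : (rho * s / 2 * b ^+ 2) * d2 y <= 6 ^+ 2 * d2 y by rewrite ler_wpM2r.
  rewrite -(ler_pM2l hrho).
  have -> : rho * (72 / rho * d2 y) = 72 * d2 y by field; rewrite gt_eqF.
  lra.
have e2 : (a * h y) ^+ 2 * s <= 16 / rho ^+ 3 * d2 y.
  have c1 : h y ^+ 2 <= (d2 y / (2 * rho)) ^+ 2.
    by rewrite ler_sqr// nnegrE divr_ge0// mulr_ge0// ltW.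
  have c2 : X ^+ 2 <= 8 ^+ 2 by rewrite ler_sqr ?nnegrE.
  rewrite -(ler_pM2r s0).
  have -> : (a * h y) ^+ 2 * s * s = X ^+ 2 * h y ^+ 2.
    by rewrite /X !exprMn real_normK ?num_real//; ring.
  apply: (@le_trans _ _ (8 ^+ 2 * (d2 y / (2 * rho)) ^+ 2)).
    by apply: ler_pM; rewrite ?sqr_ge0.
  have -> : 8 ^+ 2 * (d2 y / (2 * rho)) ^+ 2 = (16 / rho ^+ 3 * d2 y) * (rho * d2 y).
    by field; rewrite gt_eqF.
  by rewrite ler_wpM2l// mulr_ge0// divr_ge0// exprn_ge0// ltW.
have e3 : (dotv v' (y - x) + a * h y) ^+ 2 <= 2 * dotv v' (y - x) ^+ 2 + 2 * (a * h y) ^+ 2.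
  have := sqr_ge0 (dotv v' (y - x) - a * h y).
  by rewrite sqrrB sqrrD; lra.
have e4 : (dotv v' (y - x) + a * h y) ^+ 2 * s <=
    (2 * dotv v' (y - x) ^+ 2 + 2 * (a * h y) ^+ 2) * s by rewrite ler_pM2r.
rewrite /slope_bound; lra.
Qed.

End at_boundary_point.

(** Small enough for the normalised quadratic to be at most [s / 2] on the sublevel
set, and at most half of the quadratic lower bound of the gap on the boundary. *)
Definition barrier_coef : R :=
  Num.min (8 * n%:R)^-1 (rho / (2 * n%:R * slope_bound)).

Lemma slope_bound_gt0 : 0 < slope_bound.
Proof. by rewrite addr_gt0// divr_gt0// exprn_gt0. Qed.

Lemma barrier_coef_gt0 : 0 < barrier_coef.
Proof.
have N : 0 < n%:R :> R by rewrite ltr0n.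
by rewrite lt_min invr_gt0 divr_gt0 ?mulr_gt0 ?slope_bound_gt0.
Qed.

Let column (E : 'M[R]_n) k : 'rV[R]_n := \row_i E i k.

Let columnE (E : 'M[R]_n) k v : (v *m E) 0 k = dotv (column E k) v.
Proof. by rewrite mxE; apply: eq_bigr => i _; rewrite mxE mulrC. Qed.

Let column_le x s (E : 'M[R]_n) y0 : normalised (K x s) E y0 ->
  forall k y z, K x s y -> K x s z -> `|dotv (column E k) (y - z)| <= 2.
Proof.
move=> nE k y z Ky Kz; rewrite -columnE.
have -> : y - z = (y - y0) - (z - y0) by rewrite opprB addrA subrK.
rewrite mulmxBl mxE [X in _ + X]mxE; apply: le_trans (ler_normB _ _) _.
by have := nE y Ky k; have := nE z Kz k; lra.
Qed.

Let form_le x s (E : 'M[R]_n) y0 : normalised (K x s) E y0 -> K x s x ->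
  forall y, K x s y -> qform (E *m E^T) (y - x) <= 4 * n%:R.
Proof.
move=> nE Kx y Ky; rewrite qform_gram.
apply: (@le_trans _ _ (\sum_(k < n) 4)); last first.
  by rewrite sumr_const card_ord mulr_natr.
apply: ler_sum => k _; rewrite columnE -real_normK ?num_real//.
have -> : 4 = 2 ^+ 2 :> R by rewrite -natrX.
by rewrite ler_sqr ?nnegrE//; exact: column_le nE _ _ _ Ky Kx.
Qed.

(** If the sublevel set were too small, the normalised quadratic would have
large Monge-Ampere mass and could be used as a barrier. *)
Lemma normalised_comparison x (s : R) (E : 'M[R]_n) y0 (D k l : R) nu :
  normalised (K x s) E y0 -> 0 < s -> 0 < D -> \det (E *m E^T) = D ^- 2 ->
  Lambda * D ^+ 2 < (2 * (barrier_coef * s)) ^+ n ->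
  (forall y, K x s y -> bdry Omega y \/ gp x y = s ->
    k + l * dotv nu (y - x) + barrier_coef * s * qform (E *m E^T) (y - x)
      <= gp x y) ->
  forall y, K x s y ->
    k + l * dotv nu (y - x) + barrier_coef * s * qform (E *m E^T) (y - x)
      <= gp x y.
Proof.
move=> nE s0 D0 detE big; set a := barrier_coef * s.
have a0 : 0 < a by rewrite mulr_gt0// barrier_coef_gt0.
have quadE y : k + l * dotv nu (y - x) + a * qform (E *m E^T) (y - x) =
    quadratic k (l *: nu) (a *: (E *m E^T)) x y.
  by rewrite /quadratic qformZ dotvZl.
have symE i j : (E *m E^T) i j = (E *m E^T) j i.
  have T : (E *m E^T)^T = E *m E^T by rewrite trmx_mul trmxK.
  by rewrite -{1}T mxE.
move=> Hb y Ky; rewrite quadE; apply: (comparison hrho dom H) Ky => //.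
- by move=> i j; rewrite [LHS]mxE [RHS]mxE symE.
- move=> v v0; rewrite qformZ mulr_gt0//; apply: psd_det_pos v0 => //.
    by move=> w; rewrite qform_gram sumr_ge0// => i _; exact: sqr_ge0.
  by rewrite detE gt_eqF// invr_gt0 exprn_gt0.
- by rewrite detZ detE mulrA -exprMn ltr_pdivlMr ?exprn_gt0.
- by move=> z Kz zb; rewrite -quadE; exact: Hb.
Qed.

Lemma interior_sublevel_size_ge x (s : R) (E : 'M[R]_n) y0 (D : R) :
  closure Omega x -> 0 < s -> (forall y, bdry Omega y -> s <= gp x y) ->
  normalised (K x s) E y0 -> 0 < D -> \det (E *m E^T) = D ^- 2 ->
  (2 * (barrier_coef * s)) ^+ n <= Lambda * D ^+ 2.
Proof.
move=> xO s0 bs nE D0 detE; rewrite leNgt; apply/negP => big.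
have Kx : K x s x by apply: sublevel_self => //; exact: ltW.
have an : barrier_coef * (8 * n%:R) <= 1.
  rewrite -ler_pdivlMr ?mulr_gt0 ?ltr0n// div1r /barrier_coef ge_min lexx //.
have := @normalised_comparison x s E y0 D (s / 4) 0 0 nE s0 D0 detE big.
have P : forall y, K x s y -> bdry Omega y \/ gp x y = s ->
    s / 4 + 0 * dotv 0 (y - x) + barrier_coef * s * qform (E *m E^T) (y - x)
      <= gp x y.
  move=> y Ky yb; have sg : s <= gp x y by case: yb => [/bs//|->].
  have := form_le nE Kx Ky => q.
  have : barrier_coef * s * qform (E *m E^T) (y - x) <= barrier_coef * s * (4 * n%:R).
    by rewrite ler_wpM2l// mulr_ge0 ?(ltW barrier_coef_gt0) ?(ltW s0).
  have : barrier_coef * (8 * n%:R) * s <= 1 * s by rewrite ler_pM2r.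
  by rewrite mul0r; lra.
move=> /(_ P x Kx); rewrite gap_self subrr qform0 mul0r; lra.
Qed.

(** Here the barrier vanishes at the centre, and it is the positive slope [l] in the
normal direction that contradicts the tangency of the gap. *)
Lemma bdry_sublevel_size_ge x (s : R) (E : 'M[R]_n) y0 (D : R) :
  bdry Omega x -> 0 < s -> s <= threshold ->
  normalised (K x s) E y0 -> 0 < D -> \det (E *m E^T) = D ^- 2 ->
  (2 * (barrier_coef * s)) ^+ n <= Lambda * D ^+ 2.
Proof.
move=> xb s0 st nE D0 detE; rewrite leNgt; apply/negP => big.
have [xO _] := (bdryE dom x).1 xb.
have [nu bn] := exists_ball_normal hrho H xb; have nu1 := bn.1.
have Kx : K x s x by apply: sublevel_self => //; exact: ltW.
have N : 0 < n%:R :> R by rewrite ltr0n.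
have S0 := slope_bound_gt0.
have an : barrier_coef * (8 * n%:R) <= 1.
  by rewrite -ler_pdivlMr ?mulr_gt0// div1r /barrier_coef ge_min lexx.
have aS : barrier_coef * (2 * n%:R * slope_bound) <= rho.
  by rewrite -ler_pdivlMr ?mulr_gt0// /barrier_coef ge_min lexx orbT.
pose l := Num.min (rho * s / 4) (rho ^+ 2).
have l0 : 0 < l by rewrite lt_min divr_gt0 ?mulr_gt0 ?exprn_gt0.
have [l1 l2] : l <= rho * s / 4 /\ l <= rho ^+ 2.
  by rewrite /l !ge_min !lexx orbT.
have := @normalised_comparison x s E y0 D 0 l nu nE s0 D0 detE big.
have P : forall y, K x s y -> bdry Omega y \/ gp x y = s ->
    0 + l * dotv nu (y - x) + barrier_coef * s * qform (E *m E^T) (y - x)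
      <= gp x y.
  move=> y Ky yb; rewrite add0r; have hy0 := normal_ge0 hrho dom xb bn Ky.1.
  case: yb => [yb|->].
    have /andP[gd _] := gap_bdry H xb yb.
    have hd := normal_le_bdry dom bn yb.
    set d2 := dotv (y - x) (y - x) in gd hd *; set h := dotv nu (y - x) in hd hy0 *.
    have e1 : l * h <= rho / 2 * d2.
      have q1 : l * h <= rho ^+ 2 * h by rewrite ler_wpM2r.
      have q2 : rho * (2 * rho * h) <= rho * d2 by rewrite ler_pM2l.
      lra.
    have e2 : barrier_coef * s * qform (E *m E^T) (y - x) <= rho / 2 * d2.
      have q : qform (E *m E^T) (y - x) <= n%:R * (slope_bound * d2 / s).
        rewrite qform_gram; apply: (@le_trans _ _ (\sum_(k < n) slope_bound * d2 / s)).
          apply: ler_sum => k _; rewrite columnE.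
          by apply: (bdry_slope_le xb bn s0 st) => //; exact: column_le nE _.
        by rewrite sumr_const card_ord mulr_natl.
      have q2 : barrier_coef * s * qform (E *m E^T) (y - x) <=
          barrier_coef * s * (n%:R * (slope_bound * d2 / s)).
        by rewrite ler_wpM2l// mulr_ge0 ?(ltW barrier_coef_gt0) ?(ltW s0).
      apply: le_trans q2 _.
      have -> : barrier_coef * s * (n%:R * (slope_bound * d2 / s)) =
         barrier_coef * (2 * n%:R * slope_bound) * (d2 / 2).
        by field; rewrite gt_eqF.
      have : barrier_coef * (2 * n%:R * slope_bound) * (d2 / 2) <= rho * (d2 / 2).
        by rewrite ler_wpM2r// divr_ge0// dotv_ge0.
      lra.
    lra.
  have e1 : l * dotv nu (y - x) <= s / 2.
    have hr : dotv nu (y - x) <= 2 / rho.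
      rewrite -ler_sqr ?nnegrE ?divr_ge0 ?(ltW hrho)//.
      apply: le_trans (cauchy_schwarz _ _) _; rewrite nu1 mul1r.
      apply: le_trans (closure_diam hrho H xO Ky.1) _.
      by rewrite exprMn exprVn -natrX.
    have q1 : l * dotv nu (y - x) <= rho * s / 4 * dotv nu (y - x) by rewrite ler_wpM2r.
    have q2 : rho * s / 4 * dotv nu (y - x) <= rho * s / 4 * (2 / rho).
      by rewrite ler_wpM2l// divr_ge0// mulr_ge0// ltW.
    apply: le_trans q1 _; apply: le_trans q2 _; rewrite le_eqVlt; apply/orP; left.
    by apply/eqP; field; rewrite gt_eqF.
  have := form_le nE Kx Ky => q.
  have : barrier_coef * s * qform (E *m E^T) (y - x) <= barrier_coef * s * (4 * n%:R).
    by rewrite ler_wpM2l// mulr_ge0 ?(ltW barrier_coef_gt0) ?(ltW s0).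
  have : barrier_coef * (8 * n%:R) * s <= 1 * s by rewrite ler_pM2r.
  lra.
move=> /(_ P) low.
have [y Ky] := gap_sublinear hrho dom H xb bn l0 s0.
rewrite ltNge => /negP; apply; apply: le_trans (low y Ky).
rewrite add0r lerDl mulr_ge0//.
  by rewrite mulr_ge0 ?(ltW barrier_coef_gt0) ?(ltW s0).
by rewrite qform_gram sumr_ge0// => i _; exact: sqr_ge0.
Qed.

(** If the gap of [x] is at least [t / 4] on the boundary, take [z = x]. Otherwise let
[z] be the boundary point where it is least: the gap of [x] exceeds that of [z] by
at most [t / 4], as the difference of the gradients contributes a nonpositive
term. *)
Lemma sublevel_sub_msection x (t : R) : closure Omega x -> 0 < t ->
  exists z, closure Omega z /\ K z (t / 4) `<=` msection Omega phi Dphi x t /\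
    ((forall y, bdry Omega y -> t / 4 <= gp z y) \/ bdry Omega z).
Proof.
move=> xO t0.
have [||z /set_mem zb zmin] := @EVT_min_rV _ _ (gp x) (bdry Omega) _
   (compact_bdry hrho H).
- exact: (bdry_nonempty hrho dom H).
- apply: continuous_subspaceW (gap_within_continuous H (x := x)) => y.
  by case/(bdryE dom).
have [zO _] := (bdryE dom z).1 zb.
have [small|large] := ltP (gp x z) (t / 4).
  exists z; split=> //; split; last by right.
  move=> y [yO ys]; split=> //.
  have zmin' y' : bdry Omega y' -> gap phi Dphi x z <= gap phi Dphi x y'.
    by move=> /mem_set/zmin.
  have := gap_min_normal hrho dom H xO zb zmin' yO.
  move: ys small; rewrite /gap dotvBl.
  have -> : y - x = (y - z) + (z - x) by rewrite addrA subrK.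
  by rewrite (dotvDr (y - z) (z - x) (Dphi x)); lra.
exists x; split=> //; split.
  by move=> y [yO ys]; split=> //; move: ys; rewrite /gap; lra.
by left => y /mem_set/zmin; apply: le_trans.
Qed.

End lower_bound.

(** * The volume of sections *)

Lemma lebesgue_rV_mono (R : realType) (n : nat) (A B : set 'rV[R]_n) :
  A `<=` B -> (lebesgue_rV A <= lebesgue_rV B)%E.
Proof.
move=> AB; apply: ereal_inf_le_tmp => _ [a [b [[ab BE] ->]]].
by exists a, b; split=> //; split=> //; exact: subset_trans BE.
Qed.

Lemma sqr_powR_half (R : realType) (n : nat) (t : R) : 0 < t ->
  (t `^ (n%:R / 2)) ^+ 2 = t ^+ n.
Proof.
move=> t0; rewrite -(powR_mulrn 2 (powR_ge0 _ _)) -powRrM divfK ?pnatr_eq0//.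
by rewrite powR_mulrn// ltW.
Qed.

Theorem corollary2p4 (R : realType) (n : nat) (hn : (0 < n)%N)
    (rho lambda Lambda : R)
    (hrho : 0 < rho) (hlambda : 0 < lambda) (hLambda : 0 < Lambda) :
  exists c0 C1 C2 : R, [/\ 0 < c0, 0 < C1, 0 < C2 &
    forall (Omega : set 'rV[R]_n) (phi : 'rV[R]_n -> R)
      (Dphi : 'rV[R]_n -> 'rV[R]_n) (g : 'rV[R]_n -> R),
      convex_domain Omega ->
      structural_conditions rho lambda Lambda Omega phi Dphi g ->
      forall (x : 'rV[R]_n) (t : R), closure Omega x -> 0 < t -> t <= c0 ->
        ((C1 * t `^ (n%:R / 2))%:E <= lebesgue_rV (msection Omega phi Dphi x t)
           <= (C2 * t `^ (n%:R / 2))%:E)%E].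
Proof.
pose r : R := inner_radius n; have r0 : 0 < r := inner_radius_gt0 hn.
pose a : R := @barrier_coef _ n rho; have a0 : 0 < a := barrier_coef_gt0 hn hrho.
pose c1 := Num.sqrt ((a / 2) ^+ n / Lambda).
pose c2 := Num.sqrt ((4 / r ^+ 2) ^+ n / lambda).
have r20 : 0 < r ^+ 2 by exact: exprn_gt0.
have c1_arg : 0 < (a / 2) ^+ n / Lambda by apply/divr_gt0/hLambda/exprn_gt0/divr_gt0.
have c2_arg : 0 < (4 / r ^+ 2) ^+ n / lambda.
  by apply/divr_gt0/hlambda/exprn_gt0/divr_gt0.
have c10 : 0 < c1 by rewrite sqrtr_gt0.
have c20 : 0 < c2 by rewrite sqrtr_gt0.
exists (4 * @threshold _ n rho Lambda), ((2 * r) ^+ n * c1), (4 ^+ n * c2); split.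
- by rewrite mulr_gt0// threshold_gt0.
- by apply/mulr_gt0/c10/exprn_gt0/mulr_gt0.
- by apply/mulr_gt0/c20/exprn_gt0.
move=> Omega phi Dphi g dom H x t xO t0 tc; set p := t `^ _.
have p2 : p ^+ 2 = t ^+ n := sqr_powR_half n t0.
have p0 : 0 <= p := powR_ge0 _ _.
have normal_sublevel y s : closure Omega y -> 0 < s ->
    exists (E : 'M[R]_n) (y0 c : 'rV[R]_n) (D : R),
    [/\ 0 < D, normalised (sublevel Omega phi Dphi y s) E y0,
      forall z, (forall k, `|((z - c) *m E) 0 k| <= r) -> sublevel Omega phi Dphi y s z,
      \det (E *m E^T) = D ^- 2 &
      (((2 * r) ^+ n * D)%:E <= lebesgue_rV (sublevel Omega phi Dphi y s) <=
       (4 ^+ n * D)%:E)%E].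
  move=> yO s0; have [q [d [d0 qK]]] := sublevel_interior dom H yO s0.
  have cK : compact (sublevel Omega phi Dphi y s) by exact: (compact_sublevel hrho H).
  have vK : segment_closed (sublevel Omega phi Dphi y s).
    exact: (sublevel_segment dom H).
  exact: (normal_form cK vK d0 qK hn).
apply/andP; split.
- have [z [zO [zS zb]]] := sublevel_sub_msection hn hrho dom H xO t0.
  have t40 : 0 < t / 4 by rewrite divr_gt0.
  have [E [y0 [c [D [D0 nE _ detE /andP[volD _]]]]]] := normal_sublevel z (t / 4) zO t40.
  apply: le_trans (lebesgue_rV_mono zS); apply: le_trans volD.
  rewrite lee_fin -mulrA ler_pM2l; last by apply/exprn_gt0/mulr_gt0.
  have size : (2 * (a * (t / 4))) ^+ n <= Lambda * D ^+ 2.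
    case: zb => zb; first exact: (interior_sublevel_size_ge hn hrho dom H zO t40 zb nE D0 detE).
    apply: (bdry_sublevel_size_ge hn hrho hLambda dom H zb t40 _ nE D0 detE).
    by rewrite ler_pdivrMr// mulrC.
  rewrite -ler_sqr ?nnegrE ?mulr_ge0 ?(ltW c10) ?(ltW D0)//.
  rewrite exprMn sqr_sqrtr ?(ltW c1_arg)// p2 mulrAC ler_pdivrMr// -exprMn.
  rewrite (mulrC (D ^+ 2)); apply: le_trans size.
  by have -> : 2 * (a * (t / 4)) = a / 2 * t by field.
- have [E [y0 [c [D [D0 _ inner detE /andP[_ volD]]]]]] := normal_sublevel x t xO t0.
  have Sx : msection Omega phi Dphi x t `<=` sublevel Omega phi Dphi x t.
    by move=> y [yO ys]; split=> //; rewrite /gap; move: ys; lra.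
  apply: le_trans (lebesgue_rV_mono Sx) _; apply: le_trans volD _.
  rewrite lee_fin -mulrA ler_pM2l ?exprn_gt0//.
  have size := sublevel_size_le hrho hlambda dom H xO t0 r0 D0 inner detE.
  rewrite -ler_sqr ?nnegrE ?mulr_ge0 ?(ltW c20) ?(ltW D0)//.
  rewrite exprMn sqr_sqrtr ?(ltW c2_arg)// p2 mulrAC ler_pdivlMr// -exprMn.
  rewrite mulrC; apply: le_trans size _.
  by have -> : 4 * t / r ^+ 2 = 4 / r ^+ 2 * t by ring.
Qed.
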